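(* Let $\pi\colon P\to Z$ be a principal Banach bundle with structure Banach-Lie group $G$ (with Lie algebra $\mathfrak g$) and free right action $\mu\colon P\times G\to P$. The following assertions are equivalent: (1) There exists a fiberwise linear and smooth $G$-equivariant map $\chi\colon P\times_Z TZ\to TP$ such that $(T\pi)!\circ\chi=\mathrm{id}_{P\times_Z TZ}$. (2) There exists a morphism of vector bundles over $\mathrm{id}_P$ which is $G$-equivariant, $\psi\colon TP\to P\times\mathfrak g$, such that $\psi\circ\iota=\mathrm{id}_{P\times\mathfrak g}$. (3) There exists a smooth map $\omega\colon TP\to\mathfrak g$, linear on each tangent space $T_uP$, such that $\omega(T_{\mathbf 1}(\mu(u,\cdot))X)=X$ for all $X\in\mathfrak g$ and $u\in P$, and $\omega\circ T(\mu(\cdot,g))=\mathrm{Ad}_G(g^{-1})\circ\omega$ for all $g\in G$. (4) There exists a principal connection $\Phi$ on $\pi\colon P\to Z$; that is, $\Phi\colon TP\to\mathcal V P\subseteq TP$ is a connection such that $T(\mu_g)\circ\Phi=\Phi\circ T(\mu_g)$ for all $g\in G$. Then, if any of (1)--(4) holds, the relationship between $\chi,\psi,\omega,\Phi$ is given by $$\iota\circ\psi+\chi\circ(T\pi)!=\mathrm{id}_{TP},$$ $$\psi(v)=(\tau_P(v),\omega(v))\in P\times\mathfrak g\quad\text{for all } v\in TP,$$ $$\Phi=\iota\circ\psi,\qquad \omega=q\circ\Phi .$$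
   Context: Manifolds are smooth (Fréchet differentiable) Banach manifolds; $\mathfrak g=T_{\mathbf 1}G$ and $\mathrm{Ad}_G$ is the adjoint action. A principal $G$-bundle $\pi\colon P\to Z$ is a smooth map of Banach manifolds with a smooth free right action $\mu\colon P\times G\to P$, $\mu_g(x)=\mu(x,g)=\mu_x(g)$, whose orbits are the fibers of $\pi$, and such that every $z\in Z$ has an open neighborhood $V$ with a $G$-equivariant diffeomorphism $\pi^{-1}(V)\to V\times G$ over $V$. $\tau_M\colon TM\to M$ denotes the tangent bundle of $M$. $P\times_Z TZ=\{(u,v)\in P\times TZ\mid \pi(u)=\tau_Z(v)\}$, regarded as a vector bundle over $P$ via $(u,v)\mapsto u$. The map $(T\pi)!\colon TP\to P\times_Z TZ$ is $(T\pi)!(v)=(\tau_P(v),T\pi(v))$. The map $\iota\colon P\times\mathfrak g\to TP$ is $\iota(u,X)=(T_{\mathbf 1}\mu(u,\cdot))X$; it is a vector bundle isomorphism from the trivial bundle $P\times\mathfrak g\to P$, $(u,X)\mapsto u$, onto the vertical subbundle $\mathcal VP=\mathrm{Ker}(T\pi)\subseteq TP$. Put $q:=\mathrm{pr}_2\circ\iota^{-1}\colon\mathcal VP\to\mathfrak g$, where $\mathrm{pr}_2\colon P\times\mathfrak g\to\mathfrak g$ is the projection. The right actions of $G$ are: on $TP$, $(v,g)\mapsto (T\mu_g)v$; on $P\times\mathfrak g$, $((u,X),g)\mapsto(\mu(u,g),\mathrm{Ad}_G(g^{-1})X)$; on $P\times_Z TZ$, $((u,v),g)\mapsto(\mu(u,g),v)$.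 Fiberwise linearity of $\chi$ means that $\chi$ maps the fiber over $u\in P$ linearly into $T_uP$; sums of maps into $TP$ are taken in the fibers of $\tau_P$. A connection on a smooth map (fiber bundle) $\varphi\colon M\to Z$ is a smooth map $\Phi\colon TM\to TM$ such that $\Phi\circ\Phi=\Phi$, the pair $(\Phi,\mathrm{id}_M)$ is an endomorphism of the vector bundle $\tau_M\colon TM\to M$, and for every $x\in M$ the map $\Phi_x:=\Phi|_{T_xM}\colon T_xM\to T_xM$ satisfies $\mathrm{Ran}(\Phi_x)=\mathrm{Ker}(T_x\varphi)$. *)

(* Defs.v *)
From HB Require Import structures.
From mathcomp Require Import all_boot all_order all_algebra.
From mathcomp Require Import mathcomp_extra boolp classical_sets functions.
From mathcomp Require Import reals topology normedtype landau derive.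

Set Implicit Arguments.
Unset Strict Implicit.
Unset Printing Implicit Defensive.

Import Order.TTheory GRing.Theory Num.Theory.
Import numFieldNormedType.Exports.

Local Open Scope classical_set_scope.
Local Open Scope ring_scope.

HB.saturate prod.

Section prod_complete.
Variables (E F : completeType).

Lemma prod_cauchy_cvg (A : set_system (E * F)%type) :
  ProperFilter A -> cauchy A -> cvg A.
Proof.
move=> FA Ac.
have c1 : cauchy (fst @ A).
  move=> B entB; rewrite near_simpl -near2E near_map2.
  by apply: filterS (Ac _ (prod_entP entB entourageT)) => -[[a b] [c d]] [].
have c2 : cauchy (snd @ A).
  move=> B entB; rewrite near_simpl -near2E near_map2.
  by apply: filterS (Ac _ (prod_entP entourageT entB)) => -[[a b] [c d]] [].
have /cauchy_cvg v1 := c1; have /cauchy_cvg v2 := c2.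
apply/cvg_ex; exists (lim (fst @ A), lim (snd @ A)).
have := cvg_pair v1 v2.
have -> : (fun x : E * F => (x.1, x.2)) = id by apply/funext => -[].
exact.
Qed.

End prod_complete.

HB.instance Definition _ (R : numFieldType) (E F : completeNormedModType R) :=
  Uniform_isComplete.Build (E * F)%type (@prod_cauchy_cvg E F).

Section Calculus.
Context {R : realType}.
Implicit Types E F H : normedModType R.

(* Iterated Frechet differentiability of f on an open set U.  Instead of the
   operator-valued derivative x |-> 'd f x, whose target would need the normed
   space of continuous linear maps, the recursion uses its uncurried form
   (x, v) |-> 'd f x v on U x E; smoothness for all orders is the same. *)
Fixpoint smooth_n (n : nat) : forall E F, set E -> (E -> F) -> Prop :=
  match n with
  | 0 => fun E F U f => forall x, U x -> {for x, continuous f}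
  | m.+1 => fun E F U f => (forall x, U x -> differentiable f x) /\
      smooth_n m (U `*` [set: E]) (fun p : E * E => 'd f (p.1) p.2)
  end.


Lemma near_diff E F (f g : E -> F) (x : E) :
  (\forall y \near x, f y = g y) -> differentiable f x ->
  differentiable g x /\ 'd g x = 'd f x :> (E -> F).
Proof.
move=> fg df.
have fgx : f x = g x by exact: nbhs_singleton fg.
have cdf : continuous ('d f x) by apply: diff_continuous.
have dg : g \o shift x = cst (g x) + 'd f x +o_ 0 id.
  apply/eqaddoP => e e0.
  have /eqaddoP/(_ e e0) h := diff_locally df.
  have fg0 : \forall h \near (0 : E), f (h + x) = g (h + x).
    by move: fg; rewrite (near_shift 0) /= subr0.
  apply: filterS2 fg0 h => h /= fgh.
  by rewrite /= !fctE /= fgh fgx.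
have e := diff_unique cdf dg.
by split=> //; apply/diff_locallyP; rewrite e.
Qed.

Lemma openX E F (A : set E) (B : set F) : open A -> open B -> open (A `*` B).
Proof.
rewrite !openE => oA oB [x y] [/= /oA Ax /oB By].
by exists (A, B).
Qed.

Lemma smooth_n_eq n E F U (f g : E -> F) : open U ->
  (forall x, U x -> f x = g x) -> smooth_n n U f -> smooth_n n U g.
Proof.
elim: n E F U f g => [|n IH] E F U f g oU fg /=.
  move=> cf x Ux; rewrite -[_ _ _]/(g @ x --> g x) -(fg _ Ux).
  apply: cvg_trans (cf _ Ux); apply: near_eq_cvg.
  by apply: filterS (open_nbhs_nbhs (conj oU Ux)) => y /fg.
move=> [df ddf]; have nfg x : U x -> \forall y \near x, f y = g y.
  by move=> Ux; apply: filterS (open_nbhs_nbhs (conj oU Ux)) => y /fg.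
split=> [x Ux|]; first by have [] := near_diff (nfg x Ux) (df x Ux).
apply: IH ddf; first by apply: openX => //; exact: openT.
by move=> [x v] [/= Ux _]; have [_ ->] := near_diff (nfg x Ux) (df x Ux).
Qed.

Lemma smooth_n_sub n E F U V (f : E -> F) :
  V `<=` U -> smooth_n n U f -> smooth_n n V f.
Proof.
elim: n E F U V f => [|n IH] E F U V f VU /=; first by move=> cf x /VU/cf.
move=> [df ddf]; split; first by move=> x /VU/df.
by apply: IH ddf => -[x v] [/VU].
Qed.

Lemma smooth_nW n E F U (f : E -> F) : smooth_n n.+1 U f -> smooth_n n U f.
Proof.
elim: n E F U f => [|n IH] E F U f.
  by move=> [df _] x /df; exact: differentiable_continuous.
by move=> [df ddf]; split=> //; exact: IH.
Qed.

Lemma smooth_n_lin n E F U (f : {linear E -> F}) :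
  continuous f -> smooth_n n U f.
Proof.
elim: n E F U f => [|n IH] E F U f cf; first by move=> x _; exact: cf.
split=> [x _|]; first exact: linear_differentiable.
pose g : {linear (E * E)%type -> F} := f \o snd.
rewrite (_ : (fun p => _) = g); last first.
  by apply/funext => -[x v]; rewrite /= diff_lin.
apply: IH => p; apply: continuous_comp; [exact: cvg_snd | exact: cf].
Qed.

Lemma smooth_n_fst n E F U : smooth_n n U (@fst E F).
Proof. by apply: (@smooth_n_lin _ _ _ _ (@fst E F)) => p; exact: cvg_fst. Qed.

Lemma smooth_n_snd n E F U : smooth_n n U (@snd E F).
Proof. by apply: (@smooth_n_lin _ _ _ _ (@snd E F)) => p; exact: cvg_snd. Qed.

Lemma smooth_n_id n E U : smooth_n n U (@id E).
Proof. by apply: (@smooth_n_lin _ _ _ _ (@idfun E)) => p. Qed.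


Lemma smooth_n_pair n E F H U (f : E -> F) (g : E -> H) : open U ->
  smooth_n n U f -> smooth_n n U g -> smooth_n n U (fun x => (f x, g x)).
Proof.
elim: n E F H U f g => [|n IH] E F H U f g oU.
  by move=> cf cg x Ux; apply: cvg_pair; [exact: cf|exact: cg].
move=> [df ddf] [dg ddg]; have oU2 := openX oU (@openT E).
split=> [x Ux|]; first by apply: differentiable_pair; [exact: df|exact: dg].
apply: smooth_n_eq (IH _ _ _ _ _ _ oU2 ddf ddg) => // -[x v] [/= Ux _].
by rewrite (diff_pair (df _ Ux) (dg _ Ux)).
Qed.

Lemma smooth_n_comp n E F H U V (f : E -> F) (g : F -> H) : open U ->
  (forall x, U x -> V (f x)) -> smooth_n n U f -> smooth_n n V g ->
  smooth_n n U (g \o f).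
Proof.
elim: n E F H U V f g => [|n IH] E F H U V f g oU UV.
  by move=> cf cg x Ux; apply: continuous_comp; [exact: cf|exact/cg/UV].
move=> sf [dg ddg]; have oU2 := openX oU (@openT E).
have [df ddf] := sf; have sf' := smooth_nW sf.
split=> [x Ux|]; first by apply: differentiable_comp; [exact: df|exact/dg/UV].
pose k (p : E * E) := (f p.1, 'd f (p.1) p.2).
have sk : smooth_n n (U `*` setT) k.
  apply: smooth_n_pair => //.
  have U1 (p : E * E) : (U `*` setT) p -> U p.1 by move=> [].
  exact: IH oU2 U1 (@smooth_n_fst _ _ _ _) sf'.
have kV p : (U `*` setT) p -> (V `*` setT) (k p) by move=> [/UV].
apply: smooth_n_eq oU2 _ (IH _ _ _ _ _ _ _ oU2 kV sk ddg).
move=> [x v] [/= Ux _].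
by rewrite (diff_comp (df _ Ux) (dg _ (UV _ Ux))).
Qed.

Definition smooth_on E F (U : set E) (f : E -> F) := forall n, smooth_n n U f.

Lemma smooth_on_eq E F U (f g : E -> F) : open U ->
  (forall x, U x -> f x = g x) -> smooth_on U f -> smooth_on U g.
Proof. by move=> oU fg sf n; apply: smooth_n_eq (sf n). Qed.

Lemma smooth_on_sub E F U V (f : E -> F) :
  V `<=` U -> smooth_on U f -> smooth_on V f.
Proof. by move=> VU sf n; apply: smooth_n_sub (sf n). Qed.

Lemma smooth_on_pair E F H U (f : E -> F) (g : E -> H) : open U ->
  smooth_on U f -> smooth_on U g -> smooth_on U (fun x => (f x, g x)).
Proof. by move=> oU sf sg n; apply: smooth_n_pair. Qed.

Lemma smooth_on_comp E F H U V (f : E -> F) (g : F -> H) : open U ->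
  (forall x, U x -> V (f x)) -> smooth_on U f -> smooth_on V g ->
  smooth_on U (g \o f).
Proof. by move=> oU UV sf sg n; apply: smooth_n_comp UV _ _. Qed.

Lemma smooth_on_fst E F (U : set (E * F)) : smooth_on U fst.
Proof. by move=> n; exact: smooth_n_fst. Qed.

Lemma smooth_on_snd E F (U : set (E * F)) : smooth_on U snd.
Proof. by move=> n; exact: smooth_n_snd. Qed.

Lemma smooth_on_id E (U : set E) : smooth_on U id.
Proof. by move=> n; exact: smooth_n_id. Qed.

Lemma smooth_on_d E F U (f : E -> F) : smooth_on U f ->
  smooth_on (U `*` [set: E]) (fun p : E * E => 'd f (p.1) p.2).
Proof. by move=> sf n; have [] := sf n.+1. Qed.

Lemma smooth_on_differentiable E F U (f : E -> F) x :
  smooth_on U f -> U x -> differentiable f x.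
Proof. by move=> /(_ 1%N)[df _] /df. Qed.

End Calculus.

(* A Banach manifold is a set with an atlas in the sense of Lang: the topology is
   the one induced by the charts, whose model spaces may vary.  [cinv i] is the
   inverse of the chart [cmap i] and is irrelevant outside its image; [chart_at]
   chooses a chart around each point. *)
Record banach_manifold (R : realType) (M : Type) := BanachManifold {
  chart : Type;
  model : chart -> completeNormedModType R;
  cdom : chart -> set M;
  cmap : forall i, M -> model i;
  cinv : forall i, model i -> M;
  cmapK : forall i x, cdom i x -> cinv (cmap i x) = x;
  cdomI_open : forall i j, open (cmap i @` (cdom i `&` cdom j));
  ctrans_smooth : forall i j,
    smooth_on (cmap i @` (cdom i `&` cdom j)) (cmap j \o @cinv i);
  chart_at : M -> chart;
  cdom_at : forall x, cdom (chart_at x) x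
}.

Section Manifold.
Context {R : realType} {M : Type} (mM : banach_manifold R M).
Local Notation "'phi_' i" := (@cmap _ _ mM i) (at level 8, i at level 2).
Local Notation "'psi_' i" := (@cinv _ _ mM i) (at level 8, i at level 2).

Lemma cmapI (i : chart mM) (A B : set M) : phi_ i @` (cdom i `&` A `&` B) =
  phi_ i @` (cdom i `&` A) `&` phi_ i @` (cdom i `&` B).
Proof.
apply/seteqP; split => [_ [x [[dx Ax] Bx] <-]|]; first by split; exists x.
move=> _ [[x [dx Ax] <-] [y [dy By] exy]].
have /(congr1 (psi_ i)) := exy; rewrite !cmapK // => yx.
by exists x => //; split => //; rewrite -yx.
Qed.

Definition open_in (W : set M) := forall i : chart mM, open (phi_ i @` (cdom i `&` W)).

(* The tangent space at x is read in the chosen chart at x, so that it is the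
   model space of that chart; [tcoord i v] are the coordinates of v in the
   chart i. *)
Definition tspace (x : M) : completeNormedModType R := model (chart_at mM x).

Definition tbundle := {x : M & tspace x}.

Definition tcoord (i : chart mM) (v : tbundle) : model i :=
  'd (phi_ i \o psi_ (chart_at mM (tag v))) (phi_ (chart_at mM (tag v)) (tag v))
     (tagged v).

Definition tvec (i : chart mM) (y : model i) (w : model i) : tbundle :=
  existT tspace (cinv y) ('d (phi_ (chart_at mM (cinv y)) \o psi_ i) y w).

Lemma trans_diff (i j : chart mM) x : cdom i x -> cdom j x ->
  differentiable (phi_ j \o psi_ i) (phi_ i x).
Proof.
by move=> di dj; apply: smooth_on_differentiable (ctrans_smooth i j) _; exists x.
Qed.

Lemma near_cmap (i : chart mM) (W : set M) x : open (phi_ i @` (cdom i `&` W)) ->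
  cdom i x -> W x -> \forall y \near phi_ i x,
    (cdom i `&` W) (psi_ i y) /\ phi_ i (psi_ i y) = y.
Proof.
move=> oW dx Wx; have : (phi_ i @` (cdom i `&` W)) (phi_ i x) by exists x.
move=> /(conj oW)/open_nbhs_nbhs; apply: filterS => _ [z [dz Wz] <-].
by rewrite cmapK.
Qed.

Lemma trans_comp (i j k : chart mM) x w : cdom i x -> cdom j x -> cdom k x ->
  'd (phi_ k \o psi_ j) (phi_ j x) ('d (phi_ j \o psi_ i) (phi_ i x) w) =
  'd (phi_ k \o psi_ i) (phi_ i x) w.
Proof.
move=> di dj dk.
have d1 := trans_diff di dj.
have d2 : differentiable (phi_ k \o psi_ j) ((phi_ j \o psi_ i) (phi_ i x)).
  by rewrite /= cmapK //; exact: trans_diff.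
have [] := @near_diff _ _ _ ((phi_ k \o psi_ j) \o (phi_ j \o psi_ i))
  (phi_ k \o psi_ i) (phi_ i x).
- have := near_cmap (cdomI_open i j) di dj; apply: filterS => y [[_ djy] _].
  by rewrite /= cmapK.
- exact: differentiable_comp.
- by move=> _ ->; rewrite (diff_comp d1 d2) /= cmapK.
Qed.

Lemma trans_id (i : chart mM) x w : cdom i x -> 'd (phi_ i \o psi_ i) (phi_ i x) w = w.
Proof.
move=> di; have [] := @near_diff _ _ _ id (phi_ i \o psi_ i) (phi_ i x).
- have := near_cmap (cdomI_open i i) di di; apply: filterS => y [_ e].
  by rewrite /= e.
- exact: ex_diff.
- by move=> _ ->; rewrite diff_val.
Qed.

Definition tdom (i : chart mM) : set tbundle := [set v | cdom i (tag v)].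
Definition tchart (i : chart mM) (v : tbundle) : (model i * model i)%type :=
  (phi_ i (tag v), tcoord i v).
Definition tchart_inv (i : chart mM) (p : (model i * model i)%type) : tbundle :=
  tvec p.1 p.2.

Lemma tvecE (i : chart mM) x (w : model i) : cdom i x -> tvec (phi_ i x) w =
  existT tspace x ('d (phi_ (chart_at mM x) \o psi_ i) (phi_ i x) w).
Proof.
by move=> dx; rewrite /tvec; move: (phi_ i x) (cmapK dx) => {dx} y e; case: x / e.
Qed.

Lemma tchartK (i : chart mM) v : tdom i v -> tchart_inv (tchart i v) = v.
Proof.
case: v => x v; rewrite /tdom /= => dx; rewrite /tchart_inv /tchart /= tvecE //.
congr existT; rewrite trans_comp ?trans_id //; exact: cdom_at.
Qed.

Lemma tcoord_tvec (i j : chart mM) x w : cdom i x -> cdom j x ->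
  tcoord j (tvec (phi_ i x) w) = 'd (phi_ j \o psi_ i) (phi_ i x) w.
Proof.
by move=> di dj; rewrite tvecE // /tcoord /= trans_comp //; exact: cdom_at.
Qed.

Lemma tdomI (i j : chart mM) : tchart i @` (tdom i `&` tdom j) =
  (phi_ i @` (cdom i `&` cdom j)) `*` [set: model i].
Proof.
apply/seteqP; split => [_ [[x v] [/= di dj] <-]|]; first by split => //=; exists x.
move=> [y w] [[x [di dj] /= <-{y}] _]; exists (tvec (phi_ i x) w).
  by rewrite tvecE //.
by rewrite /tchart tcoord_tvec // trans_id // tvecE.
Qed.

Lemma tdomI_open (i j : chart mM) : open (tchart i @` (tdom i `&` tdom j)).
Proof. by rewrite tdomI; apply: openX; [exact: cdomI_open|exact: openT]. Qed.

Lemma ttrans_smooth (i j : chart mM) :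
  smooth_on (tchart i @` (tdom i `&` tdom j))
  (tchart j \o @tchart_inv i).
Proof.
have o := @tdomI_open i j.
have s := @ctrans_smooth _ _ mM i j.
pose T (p : (model i * model i)%type) :=
  ((phi_ j \o psi_ i) p.1, 'd (phi_ j \o psi_ i) (p.1) p.2).
apply: (@smooth_on_eq _ _ _ _ T) => //.
  rewrite tdomI => -[y w] [[x [di dj] /= <-{y}] _].
  by rewrite /tchart /tchart_inv /= tcoord_tvec // tvecE //= cmapK.
rewrite tdomI in o *; apply: smooth_on_pair => //; last exact: smooth_on_d.
by apply: smooth_on_comp o _ (@smooth_on_fst _ _ _ _) s => p [].
Qed.

Definition tangent : banach_manifold R tbundle :=
  @BanachManifold R tbundle (chart mM)
    (fun i => (model i * model i)%type) tdom tchart tchart_inv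
    tchartK tdomI_open ttrans_smooth (fun v => chart_at mM (tag v))
    (fun v => cdom_at mM (tag v)).

End Manifold.

Section Smooth_maps.
Context {R : realType} {M N : Type}.
Variables (mM : banach_manifold R M) (mN : banach_manifold R N).

(* Smoothness on the open subset W; openness of U for all charts expresses
   continuity. *)
Definition msmooth_on (W : set M) (f : M -> N) :=
  forall (i : chart mM) (j : chart mN),
    let U := cmap i @` (cdom i `&` W `&` f @^-1` cdom j) in
    open U /\ smooth_on U (cmap j \o f \o @cinv _ _ mM i).

Definition msmooth (f : M -> N) := msmooth_on setT f.

Definition tmap (f : M -> N) (v : tbundle mM) : tbundle mN :=
  let x := tag v in
  existT (tspace mN) (f x)
    ('d (cmap (chart_at mN (f x)) \o f \o @cinv _ _ mM (chart_at mM x))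
        (cmap (chart_at mM x) x) (tagged v)).

End Smooth_maps.

Section Product.
Context {R : realType} {M N : Type}.
Variables (mM : banach_manifold R M) (mN : banach_manifold R N).
Implicit Types k : (chart mM * chart mN)%type.

Definition pmodel k : completeNormedModType R := (model k.1 * model k.2)%type.
Definition pdom k : set (M * N) := cdom k.1 `*` cdom k.2.
Definition pchart k (p : M * N) : pmodel k := (cmap k.1 p.1, cmap k.2 p.2).
Definition pchart_inv k (y : pmodel k) : M * N := (cinv y.1, cinv y.2).

Lemma pchartK k p : pdom k p -> pchart_inv (pchart k p) = p.
Proof. by case: p => x y [/= dx dy]; rewrite /pchart_inv /= !cmapK. Qed.

Lemma pdomI k l : pchart k @` (pdom k `&` pdom l) =
  (cmap k.1 @` (cdom k.1 `&` cdom l.1)) `*`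
  (cmap k.2 @` (cdom k.2 `&` cdom l.2)).
Proof.
apply/seteqP; split => [_ [[x y] [[/= ? ?] [/= ? ?]] <-]|].
  by split; [exists x|exists y].
move=> [_ _] [[x [? ?] /= <-] [y [? ?] /= <-]].
by exists (x, y).
Qed.

Lemma pdomI_open k l : open (pchart k @` (pdom k `&` pdom l)).
Proof. by rewrite pdomI; apply: openX; exact: cdomI_open. Qed.

Lemma ptrans_smooth k l : smooth_on (pchart k @` (pdom k `&` pdom l))
  (pchart l \o @pchart_inv k).
Proof.
have o := @pdomI_open k l; rewrite pdomI in o *.
have s1 := @ctrans_smooth _ _ mM k.1 l.1.
have s2 := @ctrans_smooth _ _ mN k.2 l.2.
apply: smooth_on_pair => //.
  by apply: smooth_on_comp o _ (@smooth_on_fst _ _ _ _) s1 => p [].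
by apply: smooth_on_comp o _ (@smooth_on_snd _ _ _ _) s2 => p [].
Qed.

Definition prod_manifold : banach_manifold R (M * N) :=
  @BanachManifold R _ (chart mM * chart mN)%type pmodel pdom pchart pchart_inv
    pchartK pdomI_open ptrans_smooth
    (fun p => (chart_at mM p.1, chart_at mN p.2))
    (fun p => conj (cdom_at mM p.1) (cdom_at mN p.2)).

End Product.

Section Vector_space.
Context {R : realType} (E : completeNormedModType R).

Lemma vdomI_open (i j : unit) : open ((@id E) @` ([set: E] `&` [set: E])).
Proof. by rewrite setIid image_id; exact: openT. Qed.

Definition vect_manifold : banach_manifold R E :=
  @BanachManifold R E unit (fun=> E) (fun=> setT) (fun=> id) (fun=> id)
    (fun _ _ _ => erefl) vdomI_open (fun _ _ => @smooth_on_id _ _ _)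
    (fun=> tt) (fun=> I).

End Vector_space.

Section Pullback.
Context {R : realType} {M N : Type}.
Variables (mM : banach_manifold R M) (mN : banach_manifold R N) (f : M -> N).
Context (sf : msmooth mM mN f).
Implicit Types k : (chart mM * chart mN)%type.

(* The pullback of the tangent bundle of N along f, as a vector bundle over M. *)
Definition pullback := {p : M * tbundle mN | f p.1 = tag p.2}.

Definition qmodel k : completeNormedModType R := (model k.1 * model k.2)%type.
Definition qdom k : set pullback :=
  [set p | cdom k.1 (sval p).1 /\ cdom k.2 (f (sval p).1)].
Definition qchart k (p : pullback) : qmodel k :=
  (cmap k.1 (sval p).1, tcoord k.2 (sval p).2).
Definition qchart_inv k (y : qmodel k) : pullback :=
  let u := cinv y.1 in
  exist (fun p => f p.1 = tag p.2)
    (u, existT (tspace mN) (f u)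
          ('d (cmap (chart_at mN (f u)) \o @cinv _ _ mN k.2)
              (cmap k.2 (f u)) y.2))
    erefl.

Lemma qchartK k p : qdom k p -> qchart_inv (qchart k p) = p.
Proof.
case: p => -[u [z v]] /= e; case: z / e v => v [/= du dz].
rewrite /qchart_inv /qchart /=; apply: eq_exist => /=.
rewrite cmapK //; congr (_, existT _ _ _).
by rewrite trans_comp ?trans_id //; exact: cdom_at.
Qed.


Let Q (k l : (chart mM * chart mN)%type) : set (model k.1) :=
  cmap k.1 @` (cdom k.1 `&` cdom l.1) `&`
  (cmap k.1 @` (cdom k.1 `&` setT `&` f @^-1` cdom k.2) `&`
   cmap k.1 @` (cdom k.1 `&` setT `&` f @^-1` cdom l.2)).

Let QP (k l : (chart mM * chart mN)%type) (y : model k.1) : @Q k l y -> 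
  exists u, [/\ cmap k.1 u = y, cdom k.1 u, cdom l.1 u,
  cdom k.2 (f u) & cdom l.2 (f u)].
Proof.
move=> [[u [k1u l1u] uy] [[u2 [[k1u2 _] k2u2] u2y] [u3 [[k1u3 _] l2u3] u3y]]].
have e2 : u2 = u by rewrite -(cmapK k1u2) u2y -uy cmapK.
have e3 : u3 = u by rewrite -(cmapK k1u3) u3y -uy cmapK.
by rewrite e2 in k2u2; rewrite e3 in l2u3; exists u.
Qed.

Lemma qdomI k l : qchart k @` (qdom k `&` qdom l) = @Q k l `*` [set: model k.2].
Proof.
apply/seteqP; split => [_ [[[u v] e] [/= [? ?] [? ?]] <-]|].
  by split => //=; split; [|split]; exists u.
move=> [y w] [/= /QP[u [<- du lu dv lv]] _].
exists (@qchart_inv k (cmap k.1 u, w)).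
  by rewrite /qdom /= cmapK.
rewrite /qchart /qchart_inv /= cmapK // /tcoord /= trans_comp ?trans_id //.
exact: cdom_at.
Qed.

Lemma qdomI_open k l : open (qchart k @` (qdom k `&` qdom l)).
Proof.
rewrite qdomI; apply: openX; last exact: openT.
apply: openI; first exact: cdomI_open.
by apply: openI; [exact: (sf k.1 k.2).1|exact: (sf k.1 l.2).1].
Qed.

Lemma qtrans_smooth k l : smooth_on (qchart k @` (qdom k `&` qdom l))
  (qchart l \o @qchart_inv k).
Proof.
have o := @qdomI_open k l.
have s1 := @ctrans_smooth _ _ mM k.1 l.1.
have s2 := @ctrans_smooth _ _ mN k.2 l.2.
have [_ s3] := sf k.1 k.2.
pose c := cmap l.2 \o @cinv _ _ mN k.2.
pose h (p : qmodel k) := (cmap k.2 (f (cinv p.1)), p.2).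
pose T (p : qmodel k) := (cmap l.1 (cinv p.1), 'd c ((h p).1) (h p).2).
apply: (@smooth_on_eq _ _ _ _ T) => //.
  rewrite qdomI => -[y w] [/= /QP[u [<- du lu dv lv]] _].
  rewrite /T /h /qchart /= cmapK // /tcoord /= trans_comp //.
  exact: cdom_at.
rewrite qdomI in o *; apply: smooth_on_pair => //.
  by apply: smooth_on_comp o _ (@smooth_on_fst _ _ _ _) s1 => p [[]].
apply: (smooth_on_comp o _ _ (smooth_on_d s2)).
  move=> [y w] [/= /QP[u [<- du lu dv lv]] _]; split => //=.
  by exists (f u) => //; rewrite cmapK.
apply: smooth_on_pair => //; last exact: smooth_on_snd.
by apply: smooth_on_comp o _ (@smooth_on_fst _ _ _ _) s3 => p [[_ []]].
Qed.

Definition pullback_manifold : banach_manifold R pullback :=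
  @BanachManifold R _ (chart mM * chart mN)%type qmodel qdom qchart qchart_inv
    qchartK qdomI_open qtrans_smooth
    (fun p => (chart_at mM (sval p).1, chart_at mN (f (sval p).1)))
    (fun p => conj (cdom_at mM _) (cdom_at mN _)).

End Pullback.

Section Fibers.
Context {R : realType} {M : Type} (mM : banach_manifold R M).

(* The vector v of T_xM as an element of [tspace mM x] (0 if v is not over x). *)
Definition tfib (x : M) (v : tbundle mM) : tspace mM x :=
  match pselect (tag v = x) with
  | left e => eq_rect (tag v) (tspace mM) (tagged v) x e
  | right _ => 0
  end.

(* The sum of two tangent vectors at the same point. *)
Definition tadd (v w : tbundle mM) : tbundle mM :=
  existT (tspace mM) (tag v) (tagged v + tfib (tag v) w).

Definition tfiber (x : M) : set (tbundle mM) := [set v | tag v = x].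

End Fibers.

Arguments tfiber {R M} mM x.

Definition tker {R : realType} {M N : Type} (mM : banach_manifold R M)
    (mN : banach_manifold R N) (f : M -> N) : set (tbundle mM) :=
  [set v | tmap mN f v = existT (tspace mN) (f (tag v)) 0].

Definition connection {R : realType} {M Z : Type} {mM : banach_manifold R M}
    (mZ : banach_manifold R Z) (f : M -> Z) (Phi : tbundle mM -> tbundle mM) :
    Prop :=
  [/\ msmooth (tangent mM) (tangent mM) Phi,
      forall v, Phi (Phi v) = Phi v,
      forall x, exists2 L : tspace mM x -> tspace mM x, linear L &
        forall v, Phi (existT (tspace mM) x v) = existT (tspace mM) x (L v)
    & forall x, Phi @` tfiber mM x = tfiber mM x `&` tker mZ f].

Record banach_lie_group (R : realType) := BanachLieGroup {
  lie_group :> groupType;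
  lie_manifold : banach_manifold R lie_group;
  lie_mul_smooth : msmooth (prod_manifold lie_manifold lie_manifold)
    lie_manifold (fun p => (p.1 * p.2)%g);
  lie_inv_smooth : msmooth lie_manifold lie_manifold (fun g => (g^-1)%g)
}.

Section Lie_algebra.
Context {R : realType} (G : banach_lie_group R).

Definition lie_algebra : completeNormedModType R :=
  tspace (lie_manifold G) (1%g : G).

Definition Ad (g : G) (X : lie_algebra) : lie_algebra :=
  tfib (1%g : G) (tmap (lie_manifold G) (fun h => (g * h * g^-1)%g)
    (existT (tspace (lie_manifold G)) (1%g : G) X)).

End Lie_algebra.

Record principal_bundle (R : realType) (P Z : Type) (mP : banach_manifold R P)
    (mZ : banach_manifold R Z) (G : banach_lie_group R) := PrincipalBundle {
  bundle_proj : P -> Z;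
  bundle_act : P -> G -> P;
  bundle_proj_smooth : msmooth mP mZ bundle_proj;
  bundle_act_smooth : msmooth (prod_manifold mP (lie_manifold G)) mP
    (fun p => bundle_act p.1 p.2);
  bundle_act1 : forall u, bundle_act u 1%g = u;
  bundle_actM : forall u g h,
    bundle_act (bundle_act u g) h = bundle_act u (g * h)%g;
  bundle_act_free : forall u g, bundle_act u g = u -> g = 1%g;
  bundle_proj_orbit : forall u u',
    bundle_proj u = bundle_proj u' <-> exists g, u' = bundle_act u g;
  (* t : proj^-1(V) -> V x G and s are inverse diffeomorphisms; their values
     outside these sets are irrelevant. *)
  bundle_local_triv : forall z,
    exists (V : set Z) (t : P -> Z * G) (s : Z * G -> P),
    [/\ open_in mZ V /\ V z,
        msmooth_on mP (prod_manifold mZ (lie_manifold G))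
            (bundle_proj @^-1` V) t /\
          msmooth_on (prod_manifold mZ (lie_manifold G)) mP (V `*` setT) s,
        (forall u, V (bundle_proj u) -> (t u).1 = bundle_proj u) /\
          (forall p, V p.1 -> bundle_proj (s p) = p.1),
        (forall u, V (bundle_proj u) -> s (t u) = u) /\
          (forall p, V p.1 -> t (s p) = p)
      & forall u g, V (bundle_proj u) ->
          t (bundle_act u g) = ((t u).1, ((t u).2 * g)%g)]
}.

Section Connections.
Context {R : realType} {P Z : Type} {mP : banach_manifold R P}
  {mZ : banach_manifold R Z} {G : banach_lie_group R}.
Context (B : principal_bundle mP mZ G).

Local Notation g := (lie_algebra G).
Local Notation TP := (tbundle mP).
Local Notation TZ := (tbundle mZ).
Local Notation pi := (bundle_proj B).
Local Notation mu := (bundle_act B).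
Local Notation mu_ := (fun h u => bundle_act B u h).
Local Notation "1" := (1%g : G).

Definition PxTZ := pullback mZ pi.
Definition PxTZ_manifold : banach_manifold R PxTZ :=
  pullback_manifold (bundle_proj_smooth B).

Definition Pxg_manifold : banach_manifold R (P * g) :=
  prod_manifold mP (vect_manifold g).

Definition PxTZ_pair (u : P) (v : tspace mZ (pi u)) : PxTZ :=
  exist (fun p : P * TZ => pi p.1 = tag p.2)
    (u, existT (tspace mZ) (pi u) v) erefl.

Lemma bundle_proj_act u h : pi (mu u h) = pi u.
Proof. by apply/esym/bundle_proj_orbit; exists h. Qed.

Definition PxTZ_act (p : PxTZ) (h : G) : PxTZ :=
  exist (fun p : P * TZ => pi p.1 = tag p.2) (mu (sval p).1 h, (sval p).2)
    (etrans (bundle_proj_act (sval p).1 h) (svalP p)).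

Definition Pxg_act (p : P * g) (h : G) : P * g := (mu p.1 h, Ad (h^-1)%g p.2).

Definition TP_act (v : TP) (h : G) : TP := tmap mP (mu_ h) v.

(* The map (T pi)! *)
Definition Tproj (v : TP) : PxTZ :=
  exist (fun p : P * TZ => pi p.1 = tag p.2) (tag v, tmap mZ pi v) erefl.

Definition bundle_iota (p : P * g) : TP :=
  tmap mP (mu p.1) (existT (tspace (lie_manifold G)) 1 p.2).

(* The inverse of bundle_iota on its range, the vertical subbundle; the second
   branch is never used there. *)
Definition bundle_iota_inv (v : TP) : P * g :=
  match pselect (exists p, bundle_iota p = v) with
  | left e => sval (cid e)
  | right _ => (tag v, 0)
  end.

Definition qmap (v : TP) : g := (bundle_iota_inv v).2.

Definition right_splitting (chi : PxTZ -> TP) : Prop :=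
  [/\ forall u, exists2 L : tspace mZ (pi u) -> tspace mP u, linear L &
        forall v, chi (PxTZ_pair v) = existT (tspace mP) u (L v),
      msmooth PxTZ_manifold (tangent mP) chi,
      forall p h, chi (PxTZ_act p h) = TP_act (chi p) h
    & forall p, Tproj (chi p) = p].

Definition left_splitting (psi : TP -> P * g) : Prop :=
  [/\ forall u, exists2 L : tspace mP u -> g, linear L &
        forall v, psi (existT (tspace mP) u v) = (u, L v),
      msmooth (tangent mP) Pxg_manifold psi,
      forall v h, psi (TP_act v h) = Pxg_act (psi v) h
    & forall p, psi (bundle_iota p) = p].

Definition connection_form (omega : TP -> g) : Prop :=
  [/\ msmooth (tangent mP) (vect_manifold g) omega,
      forall u, linear (fun v => omega (existT (tspace mP) u v)),
      forall u X, omega (tmap mP (mu u)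
        (existT (tspace (lie_manifold G)) 1 X)) = X
    & forall h v, omega (tmap mP (mu_ h) v) = Ad (h^-1)%g (omega v)].

(* The values in the vertical subbundle are part of [connection]. *)
Definition principal_connection (Phi : TP -> TP) : Prop :=
  connection mZ pi Phi /\
  forall h v, tmap mP (mu_ h) (Phi v) = Phi (tmap mP (mu_ h) v).

Definition related (chi : PxTZ -> TP) (psi : TP -> P * g) (omega : TP -> g)
    (Phi : TP -> TP) : Prop :=
  [/\ forall v, tadd (bundle_iota (psi v)) (chi (Tproj v)) = v,
      forall v, psi v = (tag v, omega v),
      forall v, Phi v = bundle_iota (psi v)
    & forall v, omega v = qmap (Phi v)].

Definition corresponding (chi : PxTZ -> TP) (psi : TP -> P * g)
    (omega : TP -> g) (Phi : TP -> TP) : Prop :=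
  [/\ right_splitting chi, left_splitting psi, connection_form omega,
      principal_connection Phi & related chi psi omega Phi].

End Connections.

Arguments PxTZ_act {R P Z mP mZ G} B p h.
Arguments Pxg_act {R P Z mP mZ G} B p h.
Arguments TP_act {R P Z mP mZ G} B v h.
Arguments Tproj {R P Z mP mZ G} B v.
Arguments bundle_iota {R P Z mP mZ G} B p.
Arguments bundle_iota_inv {R P Z mP mZ G} B v.
Arguments qmap {R P Z mP mZ G} B v.
Arguments right_splitting {R P Z mP mZ G} B chi.
Arguments left_splitting {R P Z mP mZ G} B psi.
Arguments connection_form {R P Z mP mZ G} B omega.
Arguments principal_connection {R P Z mP mZ G} B Phi.
Arguments related {R P Z mP mZ G} B chi psi omega Phi.
Arguments corresponding {R P Z mP mZ G} B chi psi omega Phi.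

(* Main.v *)
Require Import Defs.
From HB Require Import structures.
From mathcomp Require Import all_boot all_order all_algebra.
From mathcomp Require Import boolp classical_sets functions reals.
From mathcomp Require Import topology normedtype landau derive.

Set Implicit Arguments.
Unset Strict Implicit.
Unset Printing Implicit Defensive.

Import Order.TTheory GRing.Theory Num.Theory.
Import numFieldNormedType.Exports.

Local Open Scope classical_set_scope.
Local Open Scope ring_scope.

(** At each point u of P there is an exact sequence
      0 -> g -> T_uP -> T_(pi u)Z -> 0
    whose maps are iota(u, _) and T_u pi.  A right splitting chi, a left
    splitting psi = (tau_P, omega) and a projection Phi of T_uP onto the
    vertical space are three descriptions of the same complement of the
    vertical space, linked by
      iota (psi v) + chi (Tproj v) = v  and  Phi = iota o psi,
    so everything is expressed through omega.  Equivariance passes from one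
    description to the other because T(mu_h) (iota (u, X)) is
    iota (u h, Ad(h^-1) X) ([iota_equivariant]) and because iota is injective.

    The content is exactness and smoothness, and both come from a local
    trivialization t : pi^-1(V) -> V x G with inverse s.
    - The flat form th of t is the derivative at u of
      u' |-> t2(u)^-1 t2(u').  It is smooth and fiberwise linear, it is a left
      inverse of iota over V, and iota (u, th v) = v whenever v in T_uP is
      vertical ([local_connection_form]).  So iota is injective, its range is
      Ker (T pi), and q coincides locally with th on vertical vectors.
    - The map (u, w) |-> T s (w, 0_(t2 u)) is a smooth local section of
      (T pi)! ([local_lift]).
    Hence q o Phi = th o Phi and omega v = th (v - chi (Tproj v)) are smooth,
    and for any lift v of p the vector chi p = v - iota (u, omega v) is
    independent of v, so that it can be computed with the smooth local lift
    ([horizontal_lift_splitting]).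

    The tangent functor is used through equalities between elements of the
    total space of a tangent bundle ([tmap_comp], [tmap_near], [tmap_pair]).
    These avoid transport between the fibers over two provably equal points:
    two vectors are compared through their base points and their coordinates in
    one chart ([tcoord_inj], [tcoord_tmap]). *)

(** * Smooth maps between open sets of normed spaces *)

Section Smooth_on.
Context {R : realType}.
Implicit Types E F H : normedModType R.

Lemma smooth_n_local n E F (U : set E) (f : E -> F) :
  (forall x, U x -> exists2 V, V x & smooth_n n V f) -> smooth_n n U f.
Proof.
elim: n E F U f => [|n IH] E F U f loc.
  by move=> x /loc[V Vx sf]; exact: sf.
split=> [x /loc[V Vx [df _]]|]; first exact: df.
apply: IH => -[x v] [/= /loc[V Vx [_ sf]] _].
by exists (V `*` setT).
Qed.

Lemma smooth_on_local E F (U : set E) (f : E -> F) :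
  (forall x, U x -> exists2 V, V x & smooth_on V f) -> smooth_on U f.
Proof.
move=> loc n; apply: smooth_n_local => x /loc[V Vx sf].
by exists V => //; exact: sf.
Qed.

Lemma smooth_on_lin E F (U : set E) (f : {linear E -> F}) :
  continuous f -> smooth_on U f.
Proof. by move=> cf n; exact: smooth_n_lin. Qed.

Lemma smooth_on_cst E F (U : set E) (c : F) : smooth_on U (fun=> c).
Proof.
case=> [|n]; first by move=> x _; exact: cst_continuous.
split=> [x _|]; first exact: differentiable_cst.
rewrite (_ : (fun p => _) = (\0 : {linear (E * E)%type -> F})); last first.
  by apply/funext => -[x v] /=; rewrite diff_cst.
by apply: smooth_n_lin => p; exact: cst_continuous.
Qed.

Lemma smooth_on_sub2 E : smooth_on setT (fun p : E * E => p.1 - p.2).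
Proof.
have l : linear (fun p : E * E => p.1 - p.2).
  by move=> a [x y] [z t] /=; rewrite scalerBr opprD addrACA.
pose m := GRing.isLinear.Build _ _ _ _ _ l.
pose g : {linear (E * E)%type -> E} := HB.pack (fun p : E * E => p.1 - p.2) m.
apply: (@smooth_on_lin _ _ _ g) => p /=.
by apply: cvgB; [exact: cvg_fst|exact: cvg_snd].
Qed.

Lemma open_preimage_on E F (U : set E) (V : set F) (f : E -> F) :
  open U -> (forall x, U x -> {for x, continuous f}) -> open V ->
  open (U `&` f @^-1` V).
Proof.
move=> oU cf oV; rewrite openE => x [Ux Vfx]; rewrite /interior.
apply: filterI; first exact: open_nbhs_nbhs.
by apply: cf => //; exact: open_nbhs_nbhs.
Qed.

Lemma smooth_on_continuous E F (U : set E) (f : E -> F) x :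
  smooth_on U f -> U x -> {for x, continuous f}.
Proof. by move=> /(_ 0%N); exact. Qed.

End Smooth_on.

Section Pair_calculus.
Context {R : realType}.
Implicit Types E F H : normedModType R.

Lemma smooth_on_interchange E F H H' :
  smooth_on setT (fun y : ((E * F) * (H * H'))%type =>
    ((y.1.1, y.2.1), (y.1.2, y.2.2))).
Proof.
have o := @openT ((E * F) * (H * H'))%type.
apply: smooth_on_pair => //; apply: smooth_on_pair => //.
- by apply: (smooth_on_comp o _
    (@smooth_on_fst _ (E * F)%type (H * H')%type setT)
    (@smooth_on_fst _ E F setT)).
- by apply: (smooth_on_comp o _
    (@smooth_on_snd _ (E * F)%type (H * H')%type setT)
    (@smooth_on_fst _ H H' setT)).
- by apply: (smooth_on_comp o _
    (@smooth_on_fst _ (E * F)%type (H * H')%type setT)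
    (@smooth_on_snd _ E F setT)).
- by apply: (smooth_on_comp o _
    (@smooth_on_snd _ (E * F)%type (H * H')%type setT)
    (@smooth_on_snd _ H H' setT)).
Qed.

Lemma diff_prod_map E F H H' (f : E -> H) (g : F -> H') a b v w :
  differentiable f a -> differentiable g b ->
  'd (fun p : E * F => (f p.1, g p.2)) (a, b) (v, w) = ('d f a v, 'd g b w).
Proof.
move=> df dg.
have cf : continuous (@fst E F) by move=> p; exact: cvg_fst.
have cs : continuous (@snd E F) by move=> p; exact: cvg_snd.
have d1 : differentiable (@fst E F) (a, b) by exact: linear_differentiable.
have d2 : differentiable (@snd E F) (a, b) by exact: linear_differentiable.
have df1 : differentiable (f \o fst) (a, b) by exact: differentiable_comp.
have dg2 : differentiable (g \o snd) (a, b) by exact: differentiable_comp.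
have := diff_pair df1 dg2 => /(congr1 (fun h => h (v, w))) /= ->.
rewrite (diff_comp d1) // (diff_comp d2) //=.
by rewrite !diff_lin.
Qed.

End Pair_calculus.

(** * Smoothness at a point of a manifold *)

Section Smooth_at.
Context {R : realType}.

Section Def.
Context {M N : Type} (mM : banach_manifold R M) (mN : banach_manifold R N).

(** The expression of f in the charts i and j. *)
Definition chart_rep (i : chart mM) (j : chart mN) (f : M -> N) :
  model i -> model j := cmap j \o f \o @cinv _ _ mM i.
Arguments chart_rep : clear implicits.

(** The expression of f in the charts i and j is defined and smooth near x.
    The open set U lives in the model space because a manifold carries no
    topology other than that of its charts; that f maps the part of the
    manifold described by U into the domain of j expresses continuity at x. *)
Definition smooth_in (i : chart mM) (j : chart mN) (f : M -> N) (x : M) :=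
  exists U : set (model i), [/\ open U, U (cmap i x),
    forall y, U y ->
      [/\ cdom i (cinv y), cmap i (cinv y) = y & cdom j (f (cinv y))]
    & smooth_on U (chart_rep i j f)].

(** Smoothness of f on a neighborhood of x, seen in some pair of charts; by
    [smooth_at_in] every pair of charts around x and f x then works. *)
Definition smooth_at (f : M -> N) (x : M) :=
  exists i j, cdom i x /\ smooth_in i j f x.

End Def.
Arguments chart_rep {M N mM mN} i j f.
Arguments smooth_in {M N mM mN} i j f x.

Section Change.
Context {M N : Type} {mM : banach_manifold R M} {mN : banach_manifold R N}.

Lemma smooth_in_cdom (i : chart mM) (j : chart mN) f x :
  cdom i x -> smooth_in i j f x -> cdom j (f x).
Proof. by move=> dx [U [_ Ux h _]]; have [] := h _ Ux; rewrite cmapK. Qed.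

Lemma smooth_in_diff (i : chart mM) (j : chart mN) f x :
  smooth_in i j f x -> differentiable (chart_rep i j f) (cmap i x).
Proof. by move=> [U [_ Ux _ sf]]; exact: smooth_on_differentiable sf Ux. Qed.

End Change.

Lemma smooth_in_comp {M N L : Type} {mM : banach_manifold R M}
    {mN : banach_manifold R N} {mL : banach_manifold R L}
    (i : chart mM) (j : chart mN) (k : chart mL) f g x :
  cdom i x -> smooth_in i j f x -> smooth_in j k g (f x) ->
  smooth_in i k (g \o f) x.
Proof.
move=> dx [U [oU Ux hU sf]] [V [oV Vx hV sg]].
exists (U `&` chart_rep i j f @^-1` V); split.
- by apply: open_preimage_on => // y; exact: smooth_on_continuous.
- by split => //; rewrite /= /chart_rep /= cmapK.
- by move=> y [/hU[d e dj] /hV[_ _]]; rewrite /chart_rep /= cmapK.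
- apply: (@smooth_on_eq _ _ _ _ (chart_rep j k g \o chart_rep i j f)).
  + by apply: open_preimage_on => // y; exact: smooth_on_continuous.
  + by move=> y [/hU[d e dj] _]; rewrite /chart_rep /= cmapK.
  + apply: smooth_on_comp sg => [|y []//|].
      by apply: open_preimage_on => // y; exact: smooth_on_continuous.
    by apply: smooth_on_sub sf => y [].
Qed.

(** Changes of charts are smooth; with [smooth_in_comp] this makes [smooth_at]
    independent of the charts. *)
Lemma smooth_in_id {M : Type} {mM : banach_manifold R M} (i j : chart mM) x :
  cdom i x -> cdom j x -> smooth_in i j id x.
Proof.
move=> di dj; exists (cmap i @` (cdom i `&` cdom j)); split.
- exact: cdomI_open.
- by exists x.
- by move=> _ [y [diy djy] <-]; rewrite cmapK.
- exact: ctrans_smooth.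
Qed.

Section At.
Context {M N : Type} {mM : banach_manifold R M} {mN : banach_manifold R N}.

Lemma smooth_at_in (i : chart mM) (j : chart mN) f x :
  cdom i x -> cdom j (f x) -> smooth_at mM mN f x -> smooth_in i j f x.
Proof.
move=> di dj [i' [j' [di' sf]]]; have dj' := smooth_in_cdom di' sf.
have sf' := smooth_in_comp di (smooth_in_id di di') sf.
exact: smooth_in_comp di sf' (smooth_in_id dj' dj).
Qed.

Lemma smooth_at_chart f x : smooth_at mM mN f x ->
  smooth_in (chart_at mM x) (chart_at mN (f x)) f x.
Proof. by apply: smooth_at_in; exact: cdom_at. Qed.

Lemma msmooth_on_at (W : set M) f x : msmooth_on mM mN W f -> W x ->
  smooth_at mM mN f x.
Proof.
move=> sf Wx; exists (chart_at mM x), (chart_at mN (f x)).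
split; first exact: cdom_at.
have [oU sU] := sf (chart_at mM x) (chart_at mN (f x)).
eexists; split; [exact: oU | | | exact: sU].
  by exists x => //; split; [split => //|]; exact: cdom_at.
by move=> _ [y [[dy Wy] dfy] <-]; rewrite cmapK.
Qed.

Lemma msmooth_at f x : msmooth mM mN f -> smooth_at mM mN f x.
Proof. by move=> /msmooth_on_at; exact. Qed.

Lemma at_msmooth f : (forall x, smooth_at mM mN f x) -> msmooth mM mN f.
Proof.
move=> sf i j U.
have loc y : U y -> exists V, [/\ open V, V y, V `<=` U &
    smooth_on V (chart_rep i j f)].
  move=> [x [[di _] dj] <-];
  have [V [oV Vx hV sV]] := smooth_at_in di dj (sf x).
  exists V; split => // z /hV[dz e dfz].
  by exists (cinv z).
split; last first.
  by apply: smooth_on_local => y /loc[V [_ Vy _ sV]]; exists V.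
rewrite openE => y /loc[V [oV Vy VU _]]; rewrite /interior.
by apply: filterS VU _; exact: open_nbhs_nbhs.
Qed.

Lemma open_in_near (W : set M) (i : chart mM) x : open_in mM W -> W x ->
  cdom i x -> \forall y \near cmap i x,
    (cdom i `&` W) (cinv y) /\ cmap i (cinv y) = y.
Proof. by move=> oW Wx dx; apply: near_cmap. Qed.

Lemma open_in_preimage (V : set N) f :
  (forall x, smooth_at mM mN f x) -> open_in mN V -> open_in mM (f @^-1` V).
Proof.
move=> sf oV i; rewrite openE => _ [x [dx Vfx] <-]; rewrite /interior.
have dj := cdom_at mN (f x).
have [U [oU Ux hU sU]] := smooth_at_in dx dj (sf x).
set j := chart_at mN (f x) in hU sU dj.
have o := open_preimage_on oU (fun y => @smooth_on_continuous _ _ _ _ _ y sU)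
  (oV j).
have : nbhs (cmap i x) (U `&` chart_rep i j f @^-1` (cmap j @` (cdom j `&` V))).
  apply: open_nbhs_nbhs; split=> //; split => //=.
  by exists (f x) => //; rewrite /chart_rep /= cmapK.
apply: filterS => y [/hU[d e dfy] [z [dz Vz]]] /(congr1 (@cinv _ _ mN j)).
rewrite /chart_rep /= !cmapK // => zy.
by exists (cinv y) => //; split => //=; rewrite -zy.
Qed.

Lemma smooth_at_eq (W : set M) f g x : open_in mM W -> W x ->
  (forall y, W y -> f y = g y) -> smooth_at mM mN f x -> smooth_at mM mN g x.
Proof.
move=> oW Wx fg [i [j [dx [U [oU Ux hU sf]]]]]; exists i, j; split => //.
have o : open (U `&` cmap i @` (cdom i `&` W)) by apply: openI.
have fgy y : (U `&` cmap i @` (cdom i `&` W)) y -> f (cinv y) = g (cinv y).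
  by move=> [_ [z [dz Wz] <-]]; rewrite cmapK ?fg.
exists (U `&` cmap i @` (cdom i `&` W)); split => //.
- by split => //; exists x.
- by move=> y Uy; rewrite -fgy //; apply: hU; case: Uy.
- apply: (@smooth_on_eq _ _ _ _ (chart_rep i j f)) => //.
    by move=> y Uy; rewrite /chart_rep /= fgy.
  by apply: smooth_on_sub sf => y [].
Qed.

End At.

Lemma smooth_at_comp {M N L : Type} {mM : banach_manifold R M}
    {mN : banach_manifold R N} {mL : banach_manifold R L} f g x :
  smooth_at mM mN f x -> smooth_at mN mL g (f x) -> smooth_at mM mL (g \o f) x.
Proof.
move=> sf sg; exists (chart_at mM x), (chart_at mL (g (f x))).
split; first exact: cdom_at.
exact: smooth_in_comp (cdom_at _ _) (smooth_at_chart sf) (smooth_at_chart sg).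
Qed.

(** A map h is smooth as soon as its expression in charts is a smooth function
    S of the expressions of smooth maps f and g; products, pullbacks and
    tangent bundles all have charts of this kind. *)
Lemma smooth_in_op2 {M N N' L : Type} {mM : banach_manifold R M}
    {mN : banach_manifold R N} {mN' : banach_manifold R N'}
    {mL : banach_manifold R L}
    (i : chart mM) (j : chart mN) (j' : chart mN') (l : chart mL)
    (S : model j * model j' -> model l) f g h x :
  smooth_on setT S ->
  (forall y, cdom i y -> cdom j (f y) -> cdom j' (g y) ->
    cdom l (h y) /\ cmap l (h y) = S (cmap j (f y), cmap j' (g y))) ->
  smooth_in i j f x -> smooth_in i j' g x -> smooth_in i l h x.
Proof.
move=> sS hh [U [oU Ux hU sf]] [V [oV Vx hV sg]].
have o : open (U `&` V) by exact: openI.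
exists (U `&` V); split => //.
- by move=> y [/hU[d e df] /hV[_ _ dg]]; split => //; case: (hh _ d df dg).
- apply: (@smooth_on_eq _ _ _ _
      (S \o (fun y => (chart_rep i j f y, chart_rep i j' g y)))) => //.
    move=> y [/hU[d e df] /hV[_ _ dg]]; have [_ eh] := hh _ d df dg.
    by rewrite /chart_rep /= eh.
  apply: smooth_on_comp sS => //; apply: smooth_on_pair => //.
    by apply: smooth_on_sub sf => y [].
  by apply: smooth_on_sub sg => y [].
Qed.

Lemma smooth_in_op1 {M N L : Type} {mM : banach_manifold R M}
    {mN : banach_manifold R N} {mL : banach_manifold R L}
    (i : chart mM) (j : chart mN) (l : chart mL)
    (S : model j -> model l) f h x :
  smooth_on setT S ->
  (forall y, cdom i y -> cdom j (f y) ->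
    cdom l (h y) /\ cmap l (h y) = S (cmap j (f y))) ->
  smooth_in i j f x -> smooth_in i l h x.
Proof.
move=> sS hh sf.
apply: (@smooth_in_op2 _ _ _ _ _ _ _ _ _ _ _ _ (S \o fst) f f h x _ _ sf sf).
  by apply: smooth_on_comp sS => //; [exact: openT|exact: smooth_on_fst].
by move=> y d df _; exact: hh.
Qed.

End Smooth_at.

Arguments chart_rep {R M N mM mN} i j f.
Arguments smooth_in {R M N mM mN} i j f x.

(** * Smooth maps into products and tangent bundles *)

Section Basic_smooth_maps.
Context {R : realType}.

Section Unary.
Context {M : Type} {mM : banach_manifold R M}.

Lemma smooth_at_id x : smooth_at mM mM id x.
Proof.
have d := cdom_at mM x.
by exists (chart_at mM x), (chart_at mM x); split => //; exact: smooth_in_id.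
Qed.

Lemma smooth_at_cst {N : Type} {mN : banach_manifold R N} (z : N) x :
  smooth_at mM mN (fun=> z) x.
Proof.
have d := cdom_at mM x; exists (chart_at mM x), (chart_at mN z); split => //.
apply: (@smooth_in_op1 _ _ _ _ _ _ _ _ _ _
  (fun=> cmap (chart_at mN z) z) id _ x _ _ (smooth_in_id d d)).
  exact: smooth_on_cst.
by move=> y _ _; split => //; exact: cdom_at.
Qed.

Lemma smooth_at_tag v : smooth_at (tangent mM) mM tag v.
Proof.
have d : cdom (chart_at (tangent mM) v) v by exact: cdom_at.
exists (chart_at (tangent mM) v), (chart_at mM (tag v)); split => //.
apply: (@smooth_in_op1 _ _ _ _ _ (tangent mM) _ _
  (chart_at (tangent mM) v) (chart_at mM (tag v)) fst id _ v _ _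
  (smooth_in_id d d)) => //.
exact: smooth_on_fst.
Qed.

Lemma smooth_at_tcoord (i : chart mM) v : cdom i (tag v) ->
  smooth_at (tangent mM) (vect_manifold (model i)) (tcoord i) v.
Proof.
move=> d; exists (i : chart (tangent mM)), tt; split => //.
apply: (@smooth_in_op1 _ _ _ _ _ (tangent mM) (vect_manifold (model i)) _
  i tt snd id _ v _ _
  (smooth_in_id (d : cdom (i : chart (tangent mM)) v) d)) => //.
exact: smooth_on_snd.
Qed.

(** The zero tangent vector at x. *)
Definition tzero (x : M) : tbundle mM := existT (tspace mM) x 0.

Lemma tcoord_tzero (i : chart mM) x : tcoord i (tzero x) = 0.
Proof. by rewrite /tcoord linear0. Qed.

Lemma smooth_at_tzero x : smooth_at mM (tangent mM) tzero x.
Proof.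
have d := cdom_at mM x; exists (chart_at mM x), (chart_at mM x); split => //.
apply: (@smooth_in_op1 _ _ _ _ _ _ _ _ _ (chart_at mM x : chart (tangent mM))
   (fun a => (a, 0)) id _ x _ _ (smooth_in_id d d)).
  apply: smooth_on_pair; first exact: openT.
  - exact: smooth_on_id.
  - exact: smooth_on_cst.
by move=> y dy _; split => //; rewrite /= /tchart tcoord_tzero.
Qed.

Lemma smooth_at_vector x (X : tspace mM x) :
  smooth_at (vect_manifold (tspace mM x)) (tangent mM) (existT (tspace mM) x) X.
Proof.
have d := cdom_at mM x.
exists (tt : chart (vect_manifold (tspace mM x))),
  (chart_at mM x : chart (tangent mM)).
split => //.
refine (@smooth_in_op1 _ _ _ _ (vect_manifold (tspace mM x))
   (vect_manifold (tspace mM x)) (tangent mM) tt tt (chart_at mM x)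
   (fun a => (cmap (chart_at mM x) x, a)) id _ X _ _
   (@smooth_in_id _ _ (vect_manifold (tspace mM x)) tt tt X I I)).
  apply: smooth_on_pair; first exact: openT.
  - exact: smooth_on_cst.
  - exact: smooth_on_id.
by move=> y dy _; split => //; rewrite /= /tchart /tcoord /= trans_id.
Qed.

End Unary.

Section Binary.
Context {M N : Type} {mM : banach_manifold R M} {mN : banach_manifold R N}.

Lemma smooth_at_fst p : smooth_at (prod_manifold mM mN) mM fst p.
Proof.
have d : cdom (chart_at (prod_manifold mM mN) p) p by exact: cdom_at.
exists (chart_at (prod_manifold mM mN) p), (chart_at mM p.1); split => //.
apply: (@smooth_in_op1 _ _ _ _ _ (prod_manifold mM mN) _ _
  (chart_at (prod_manifold mM mN) p) (chart_at mM p.1) fst id _ p _ _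
  (smooth_in_id d d)).
  exact: smooth_on_fst.
by move=> y [].
Qed.

Lemma smooth_at_snd p : smooth_at (prod_manifold mM mN) mN snd p.
Proof.
have d : cdom (chart_at (prod_manifold mM mN) p) p by exact: cdom_at.
exists (chart_at (prod_manifold mM mN) p), (chart_at mN p.2); split => //.
apply: (@smooth_in_op1 _ _ _ _ _ (prod_manifold mM mN) _ _
  (chart_at (prod_manifold mM mN) p) (chart_at mN p.2) snd id _ p _ _
  (smooth_in_id d d)).
  exact: smooth_on_snd.
by move=> y [].
Qed.

Lemma smooth_at_pair {L : Type} {mL : banach_manifold R L}
    (f : L -> M) (g : L -> N) x : smooth_at mL mM f x -> smooth_at mL mN g x ->
  smooth_at mL (prod_manifold mM mN) (fun y => (f y, g y)) x.
Proof.
move=> sf sg; have {}sf := smooth_at_chart sf; have {}sg := smooth_at_chart sg.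
exists (chart_at mL x), (chart_at mM (f x), chart_at mN (g x)).
split; first exact: cdom_at.
apply: (@smooth_in_op2 _ _ _ _ _ _ _ _ (prod_manifold mM mN) _ _ _
  (chart_at mM (f x), chart_at mN (g x)) id _ _ _ x _ _ sf sg) => //.
exact: smooth_on_id.
Qed.

(** The identification of TM x TN with T(M x N).  The chosen chart of the
    product at a point is the product of the chosen charts, so the fibers agree
    by definition. *)
Definition tpair (v : tbundle mM) (w : tbundle mN) :
    tbundle (prod_manifold mM mN) :=
  existT (tspace (prod_manifold mM mN)) (tag v, tag w) (tagged v, tagged w).

End Binary.

(** A map into a tangent bundle is smooth when its base point and its
    coordinates in one chart are. *)
Lemma smooth_at_tvector {M N : Type} {mM : banach_manifold R M}
    {mN : banach_manifold R N} (j : chart mN) (f : M -> tbundle mN) x :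
  cdom j (tag (f x)) ->
  smooth_at mM mN (tag \o f) x ->
  smooth_at mM (vect_manifold (model j)) (tcoord j \o f) x ->
  smooth_at mM (tangent mN) f x.
Proof.
move=> dj sf sg; have di := cdom_at mM x.
exists (chart_at mM x), (j : chart (tangent mN)); split => //.
have sf' := smooth_at_in di dj sf.
have sg' := @smooth_at_in _ _ _ _ (vect_manifold (model j)) _ tt _ _ di I sg.
apply: (@smooth_in_op2 _ _ _ _ _ _ mN (vect_manifold (model j)) (tangent mN)
  (chart_at mM x) j tt j id (tag \o f) (tcoord j \o f) f x _ _ sf' sg') => //.
exact: smooth_on_id.
Qed.

Lemma smooth_at_sub {M : Type} {mM : banach_manifold R M}
    {E : completeNormedModType R} (f g : M -> E) x :
  smooth_at mM (vect_manifold E) f x -> smooth_at mM (vect_manifold E) g x ->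
  smooth_at mM (vect_manifold E) (fun y => f y - g y) x.
Proof.
move=> sf sg; have {}sf := smooth_at_chart sf; have {}sg := smooth_at_chart sg.
exists (chart_at mM x), tt; split; first exact: cdom_at.
apply: (@smooth_in_op2 _ _ _ _ _ _ _ _ (vect_manifold E) _ _ _ tt
  (fun p => p.1 - p.2) _ _ _ x _ _ sf sg) => //.
exact: smooth_on_sub2.
Qed.

End Basic_smooth_maps.

Arguments tzero {R M} mM x.

(** * The tangent functor *)

Section Tangent_map.
Context {R : realType}.

(** The chain rule in arbitrary charts. *)
Lemma chart_rep_comp {M N L : Type} {mM : banach_manifold R M}
    {mN : banach_manifold R N} {mL : banach_manifold R L}
    (i : chart mM) (j : chart mN) (k : chart mL) f g x w :
  cdom i x -> smooth_in i j f x -> smooth_in j k g (f x) ->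
  'd (chart_rep j k g) (cmap j (f x)) ('d (chart_rep i j f) (cmap i x) w) =
  'd (chart_rep i k (g \o f)) (cmap i x) w.
Proof.
move=> dx sf sg.
have df := smooth_in_diff sf; have dg := smooth_in_diff sg.
have e : chart_rep i j f (cmap i x) = cmap j (f x).
  by rewrite /chart_rep /= cmapK.
have dg' : differentiable (chart_rep j k g) (chart_rep i j f (cmap i x)).
  by rewrite e.
have [] := @near_diff _ _ _ (chart_rep j k g \o chart_rep i j f)
  (chart_rep i k (g \o f)) (cmap i x).
- have [U [oU Ux hU _]] := sf.
  have : nbhs (cmap i x) U by exact: open_nbhs_nbhs.
  by apply: filterS => y /hU[_ _ dy]; rewrite /chart_rep /= cmapK.
- exact: differentiable_comp.
- by move=> _ ->; rewrite (diff_comp df dg') /= e.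
Qed.

Lemma tcoord_inj {M : Type} {mM : banach_manifold R M} (i : chart mM)
    (v w : tbundle mM) : cdom i (tag v) ->
  tag v = tag w -> tcoord i v = tcoord i w -> v = w.
Proof.
move=> d e ec; rewrite -(tchartK (d : tdom i v)).
have d' : tdom i w by rewrite /tdom /= -e.
by rewrite -(tchartK d') /tchart e ec.
Qed.

Section One.
Context {M N : Type} {mM : banach_manifold R M} {mN : banach_manifold R N}.

Lemma tcoord_tmap (i : chart mM) (j : chart mN) f v :
  smooth_at mM mN f (tag v) -> cdom i (tag v) -> cdom j (f (tag v)) ->
  tcoord j (tmap mN f v) = 'd (chart_rep i j f) (cmap i (tag v)) (tcoord i v).
Proof.
move=> sf di dj.
have di0 := cdom_at mM (tag v); have dj0 := cdom_at mN (f (tag v)).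
have := chart_rep_comp (tagged v) di0 (smooth_in_id di0 di)
  (smooth_at_in di dj sf).
rewrite /tcoord => ->.
by have := chart_rep_comp (tagged v) di0 (smooth_at_in di0 dj0 sf)
  (smooth_in_id dj0 dj).
Qed.

Lemma tmap_near (W : set M) f g (v : tbundle mM) : open_in mM W -> W (tag v) ->
  (forall y, W y -> f y = g y) -> smooth_at mM mN f (tag v) ->
  tmap mN f v = tmap mN g v.
Proof.
move=> oW Wv fg sf; have sg := smooth_at_eq oW Wv fg sf.
have di := cdom_at mM (tag v); have dj := cdom_at mN (f (tag v)).
have dj' : cdom (chart_at mN (f (tag v))) (g (tag v)) by rewrite -fg.
apply: (@tcoord_inj _ mN (chart_at mN (f (tag v)))) => //=; first exact: fg.
rewrite (tcoord_tmap sf di dj) (tcoord_tmap sg di dj').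
set i := chart_at mM (tag v) in di *.
set j := chart_at mN (f (tag v)) in dj dj' *.
have ij : \forall y \near cmap i (tag v), chart_rep i j f y = chart_rep i j g y.
  apply: filterS (open_in_near oW Wv di) => y [[_ Wy] _].
  by rewrite /chart_rep /= fg.
have [_ e] := near_diff ij (smooth_in_diff (smooth_at_in di dj sf)).
exact: esym (congr1 (fun h : model i -> model j => h (tcoord i v)) e).
Qed.

Lemma smooth_at_tmap f (v : tbundle mM) : smooth_at mM mN f (tag v) ->
  smooth_at (tangent mM) (tangent mN) (tmap mN f) v.
Proof.
move=> sf; have di := cdom_at mM (tag v); have dj := cdom_at mN (f (tag v)).
have [U [oU Ux hU sU]] := smooth_at_in di dj sf.
set i := chart_at mM (tag v) in di U oU Ux hU sU *.
set j := chart_at mN (f (tag v)) in dj U oU Ux hU sU *.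
exists (i : chart (tangent mM)), (j : chart (tangent mN)); split => //.
have oU' : open (U `*` [set: model i]) by apply: openX => //; exact: openT.
have cU y w : U y -> tchart i (tvec y w) = (y, w).
  move=> /hU[d e _]; rewrite /tchart /=; congr pair => //.
  by rewrite -{1}e tcoord_tvec // trans_id.
have sfU y : U y -> smooth_at mM mN f (cinv y).
  move=> Uy; have [d e _] := hU _ Uy; exists i, j; split => //.
  by exists U; split => //; rewrite e.
exists (U `*` setT); split => //.
  by move=> [y w] [/= Uy _]; have [d e df] := hU _ Uy; split => //; exact: cU.
refine (@smooth_on_eq _ (model i * model i)%type (model j * model j)%type _
  (fun p => (chart_rep i j f p.1, 'd (chart_rep i j f) (p.1) p.2)) _ oU' _ _).
  move=> [y w] [/= Uy _]; have [d e df] := hU _ Uy.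
  rewrite /chart_rep /= /tchart /=; congr pair.
  have := tcoord_tmap (v := tvec y w) (sfU _ Uy) d df.
  by rewrite /= e => ->; have [_ ->] := cU _ w Uy.
apply: smooth_on_pair => //; last exact: smooth_on_d.
by apply: smooth_on_comp oU' _ (@smooth_on_fst _ _ _ _) sU => p [].
Qed.

Lemma tmap_cst (z : N) (v : tbundle mM) : tmap mN (fun=> z) v = tzero mN z.
Proof. by rewrite /tmap /tzero diff_cst. Qed.

End One.

Lemma tmap_id {M : Type} {mM : banach_manifold R M} (v : tbundle mM) :
  tmap mM id v = v.
Proof.
have d := cdom_at mM (tag v).
apply: (@tcoord_inj _ mM (chart_at mM (tag v))) => //.
by rewrite (tcoord_tmap (smooth_at_id _) d d) /chart_rep trans_id.
Qed.

Lemma tmap_comp {M N L : Type} {mM : banach_manifold R M}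
    {mN : banach_manifold R N} {mL : banach_manifold R L} f g (v : tbundle mM) :
  smooth_at mM mN f (tag v) -> smooth_at mN mL g (f (tag v)) ->
  tmap mL g (tmap mN f v) = tmap mL (g \o f) v.
Proof.
move=> sf sg; have {}sf := smooth_at_chart sf; have {}sg := smooth_at_chart sg.
congr existT.
exact: (chart_rep_comp (tagged v) (cdom_at mM (tag v)) sf sg).
Qed.

Lemma tmap_pair {M N L : Type} {mM : banach_manifold R M}
    {mN : banach_manifold R N} {mL : banach_manifold R L} f g (v : tbundle mL) :
  smooth_at mL mM f (tag v) -> smooth_at mL mN g (tag v) ->
  tmap (prod_manifold mM mN) (fun x => (f x, g x)) v =
  tpair (tmap mM f v) (tmap mN g v).
Proof.
move=> sf sg; have {}sf := smooth_at_chart sf; have {}sg := smooth_at_chart sg.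
congr existT.
have := diff_pair (smooth_in_diff sf) (smooth_in_diff sg).
by move=> /(congr1 (fun h => h (tagged v))).
Qed.

Section Tpair.
Context {M N : Type} {mM : banach_manifold R M} {mN : banach_manifold R N}.

Lemma tcoord_tpair (k : chart (prod_manifold mM mN)) (v : tbundle mM)
    (w : tbundle mN) : cdom k (tag v, tag w) ->
  tcoord k (tpair v w) = (tcoord k.1 v, tcoord k.2 w).
Proof.
move=> [/= dv dw].
have d1 := trans_diff (cdom_at mM (tag v)) dv.
have d2 := trans_diff (cdom_at mN (tag w)) dw.
exact: (diff_prod_map (tagged v) (tagged w) d1 d2).
Qed.

Lemma smooth_at_tpair p :
  smooth_at (prod_manifold (tangent mM) (tangent mN))
    (tangent (prod_manifold mM mN)) (fun p => tpair p.1 p.2) p.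
Proof.
have d : cdom (chart_at (prod_manifold (tangent mM) (tangent mN)) p) p.
  exact: cdom_at.
exists (chart_at (prod_manifold (tangent mM) (tangent mN)) p),
  (chart_at mM (tag p.1), chart_at mN (tag p.2)).
split => //.
apply: (@smooth_in_op1 _ _ _ _ _ (prod_manifold (tangent mM) (tangent mN))
  (tangent (prod_manifold mM mN))
  _ (chart_at (prod_manifold (tangent mM) (tangent mN)) p)
  (chart_at mM (tag p.1), chart_at mN (tag p.2))
  (fun y => ((y.1.1, y.2.1), (y.1.2, y.2.2))) id _ p _ _ (smooth_in_id d d)).
  exact: smooth_on_interchange.
move=> [v w] [dv dw] _; split => //=.
by rewrite /tchart tcoord_tpair.
Qed.
End Tpair.
End Tangent_map.

(** * Smooth maps into a pullback of a tangent bundle *)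

Section Pullback_maps.
Context {R : realType} {M N : Type} {mM : banach_manifold R M}
  {mN : banach_manifold R N} {f : M -> N} (sf : msmooth mM mN f).

Lemma smooth_at_pullback_fst p :
  smooth_at (pullback_manifold sf) mM (fun p => (sval p).1) p.
Proof.
have d : cdom (chart_at (pullback_manifold sf) p) p by exact: cdom_at.
exists (chart_at (pullback_manifold sf) p), (chart_at mM (sval p).1).
split => //.
apply: (@smooth_in_op1 _ _ _ _ _ (pullback_manifold sf) _ _
  (chart_at (pullback_manifold sf) p) (chart_at mM (sval p).1) fst id _ p _ _
  (smooth_in_id d d)).
  exact: smooth_on_fst.
by move=> y [].
Qed.

Lemma smooth_at_pullback_snd p :
  smooth_at (pullback_manifold sf) (tangent mN) (fun p => (sval p).2) p.
Proof.
apply: (@smooth_at_tvector _ _ _ _ _ (chart_at mN (f (sval p).1))).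
- by rewrite -(svalP p); exact: cdom_at.
- rewrite (_ : _ \o _ = f \o (fun p => (sval p).1)).
    exact: smooth_at_comp (smooth_at_pullback_fst p) (msmooth_at _ sf).
  by apply/funext => q /=; rewrite (svalP q).
- have d : cdom (chart_at (pullback_manifold sf) p) p by exact: cdom_at.
  exists (chart_at (pullback_manifold sf) p), tt; split => //.
  apply: (@smooth_in_op1 _ _ _ _ _ (pullback_manifold sf)
    (vect_manifold (model (chart_at mN (f (sval p).1)))) _
    (chart_at (pullback_manifold sf) p) tt snd id _ p _ _
    (smooth_in_id d d)) => //.
  exact: smooth_on_snd.
Qed.

Lemma smooth_at_pullback {L : Type} {mL : banach_manifold R L}
    (F : L -> pullback mN f) x :
  smooth_at mL mM (fun y => (sval (F y)).1) x ->
  smooth_at mL (tangent mN) (fun y => (sval (F y)).2) x ->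
  smooth_at mL (pullback_manifold sf) F x.
Proof.
move=> s1 s2; have di := cdom_at mL x.
have d1 := cdom_at mM (sval (F x)).1.
have d2 : cdom (chart_at mN (f (sval (F x)).1) : chart (tangent mN))
    (sval (F x)).2.
  by rewrite /= /tdom /= -(svalP (F x)); exact: cdom_at.
exists (chart_at mL x), (chart_at (pullback_manifold sf) (F x)); split => //.
apply: (@smooth_in_op2 _ _ _ _ _ _ _ (tangent mN) (pullback_manifold sf) _ _ _
  (chart_at (pullback_manifold sf) (F x)) (fun p => (p.1, p.2.2)) _ _ _ x _ _
  (smooth_at_in di d1 s1) (smooth_at_in di d2 s2)).
  apply: smooth_on_pair; [exact: openT|exact: smooth_on_fst|].
  have o := @openT (model (chart_at mM (sval (F x)).1) *
    (model (chart_at mN (f (sval (F x)).1)) *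
     model (chart_at mN (f (sval (F x)).1))))%type.
  by apply: (smooth_on_comp o _ (@smooth_on_snd _ _ _ setT)
    (@smooth_on_snd _ _ _ setT)).
by move=> y dy /= d1y d2y; split => //; split => //=; rewrite (svalP (F y)).
Qed.

End Pullback_maps.

(** * Fiberwise operations on tangent vectors *)

Section Fiberwise.
Context {R : realType} {M : Type} {mM : banach_manifold R M}.
Implicit Types v w : tbundle mM.

Lemma tfibE x (a : tspace mM x) : tfib x (existT (tspace mM) x a) = a.
Proof.
by rewrite /tfib; case: pselect => //= e; rewrite (Prop_irrelevance e erefl).
Qed.

Lemma tfibK x v : tag v = x -> existT (tspace mM) x (tfib x v) = v.
Proof. by case: v => y a /= <-; rewrite tfibE. Qed.

Lemma existT_tspace_inj x : injective (existT (tspace mM) x).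
Proof. by move=> a b /(congr1 (tfib x)); rewrite !tfibE. Qed.

Lemma tfib_linear x y : linear (fun a => tfib x (existT (tspace mM) y a)).
Proof.
move=> r a b; rewrite /tfib /=; case: pselect => [e|_].
  by case: x / e.
by rewrite scaler0 addr0.
Qed.

Lemma tcoord_linear (i : chart mM) x :
  linear (fun a => tcoord i (existT (tspace mM) x a)).
Proof. by move=> r a b; rewrite /tcoord /= linearP. Qed.

Lemma tcoord_at (x : M) (a : tspace mM x) :
  tcoord (chart_at mM x) (existT (tspace mM) x a) = a.
Proof. by rewrite /tcoord /= trans_id //; exact: cdom_at. Qed.

Lemma tcoord_atK x v : tag v = x ->
  existT (tspace mM) x (tcoord (chart_at mM x) v) = v.
Proof. by case: v => y a /= <-; rewrite tcoord_at. Qed.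

(** The difference of two tangent vectors at the same point, in the convention
    of [tadd]: the second vector counts as 0 if it is over another point. *)
Definition tsub v w : tbundle mM :=
  existT (tspace mM) (tag v) (tagged v - tfib (tag v) w).

Lemma tsubE x (a b : tspace mM x) :
  tsub (existT (tspace mM) x a) (existT (tspace mM) x b) =
  existT (tspace mM) x (a - b).
Proof. by rewrite /tsub /= tfibE. Qed.

Lemma taddE x (a b : tspace mM x) :
  tadd (existT (tspace mM) x a) (existT (tspace mM) x b) =
  existT (tspace mM) x (a + b).
Proof. by rewrite /tadd /= tfibE. Qed.

Lemma tcoord_tsub (i : chart mM) v w : tag v = tag w ->
  tcoord i (tsub v w) = tcoord i v - tcoord i w.
Proof.
case: v w => [x a] [y b] /= e; case: y / e b => b; rewrite tsubE.
by rewrite /tcoord /= linearB.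
Qed.

Lemma smooth_at_tsub {N : Type} {mN : banach_manifold R N}
    (f g : N -> tbundle mM) x : (forall y, tag (f y) = tag (g y)) ->
  smooth_at mN (tangent mM) f x -> smooth_at mN (tangent mM) g x ->
  smooth_at mN (tangent mM) (fun y => tsub (f y) (g y)) x.
Proof.
move=> e sf sg.
have d := cdom_at mM (tag (f x)).
apply: (@smooth_at_tvector _ _ _ _ _ (chart_at mM (tag (f x)))) => //.
  exact: smooth_at_comp sf (smooth_at_tag _).
rewrite (_ : _ \o _ = (fun y => tcoord (chart_at mM (tag (f x))) (f y) -
   tcoord (chart_at mM (tag (f x))) (g y))); last first.
  by apply/funext => y /=; rewrite tcoord_tsub.
apply: smooth_at_sub.
  exact: smooth_at_comp sf (smooth_at_tcoord d).
by apply: smooth_at_comp sg (smooth_at_tcoord _); rewrite -e.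
Qed.

End Fiberwise.

Section Tmap_linear.
Context {R : realType} {M N L : Type} {mM : banach_manifold R M}
  {mN : banach_manifold R N} {mL : banach_manifold R L}.

(** The differential of f at x as a map between the tangent spaces. *)
Definition tdiff (f : M -> N) x : tspace mM x -> tspace mN (f x) :=
  'd (chart_rep (chart_at mM x) (chart_at mN (f x)) f) (cmap (chart_at mM x) x).

Lemma tdiff_linear f x : linear (tdiff f (x := x)).
Proof. by move=> r a b; rewrite /tdiff linearP. Qed.

Lemma tdiffB f x (a b : tspace mM x) : tdiff f (a - b) = tdiff f a - tdiff f b.
Proof. exact: linearB. Qed.

Lemma tmapE f x (a : tspace mM x) :
  tmap mN f (existT (tspace mM) x a) = existT (tspace mN) (f x) (tdiff f a).
Proof. by []. Qed.

Lemma tmap_tsub f (v w : tbundle mM) : tag v = tag w ->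
  tmap mN f (tsub v w) = tsub (tmap mN f v) (tmap mN f w).
Proof.
case: v w => [x a] [y b] /= e; case: y / e b => b.
by rewrite tsubE !tmapE tsubE /tdiff linearB.
Qed.

(** The tangent map of F at (0_a, w) is the tangent map of the partial map
    F(a, _). *)
Lemma tmap_partial2 (F : M * L -> N) a (w : tbundle mL) :
  smooth_at (prod_manifold mM mL) mN F (a, tag w) ->
  tmap mN F (tpair (tzero mM a) w) = tmap mN (fun k => F (a, k)) w.
Proof.
move=> sF; rewrite -(tmap_cst (mN := mM) a w) -{2}(tmap_id w).
have sc : smooth_at mL mM (fun=> a) (tag w) by exact: smooth_at_cst.
rewrite -(tmap_pair sc (smooth_at_id _)) tmap_comp //.
exact: smooth_at_pair sc (smooth_at_id _).
Qed.

Lemma tmap_partial1 (F : M * L -> N) (v : tbundle mM) b :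
  smooth_at (prod_manifold mM mL) mN F (tag v, b) ->
  tmap mN F (tpair v (tzero mL b)) = tmap mN (fun x => F (x, b)) v.
Proof.
move=> sF; rewrite -(tmap_cst (mN := mL) b v) -{1}(tmap_id v).
have sc : smooth_at mM mL (fun=> b) (tag v) by exact: smooth_at_cst.
rewrite -(tmap_pair (smooth_at_id _) sc) tmap_comp //.
exact: smooth_at_pair (smooth_at_id _) sc.
Qed.

End Tmap_linear.

(** * Local connection forms and local lifts *)

Section Bundle_geometry.
Context {R : realType} {P Z : Type} {mP : banach_manifold R P}
  {mZ : banach_manifold R Z} {G : banach_lie_group R}.
Context (B : principal_bundle mP mZ G).

Local Notation g := (lie_algebra G).
Local Notation mG := (lie_manifold G).
Local Notation TP := (tbundle mP).
Local Notation pi := (bundle_proj B).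
Local Notation mu := (bundle_act B).
Local Notation mu_ := (fun h u => bundle_act B u h).
Local Notation vec := (existT (tspace mG) (1%g : G)).

Lemma smooth_at_pi u : smooth_at mP mZ pi u.
Proof. exact: msmooth_at (bundle_proj_smooth B). Qed.

Lemma smooth_at_act p :
  smooth_at (prod_manifold mP mG) mP (fun p => mu p.1 p.2) p.
Proof. exact: msmooth_at (bundle_act_smooth B). Qed.

Lemma smooth_at_orbit_map u k : smooth_at mG mP (mu u) k.
Proof.
have := smooth_at_comp (smooth_at_pair (smooth_at_cst (mM := mG) (mN := mP) u k)
  (smooth_at_id k)) (smooth_at_act _); exact.
Qed.

Lemma smooth_at_translation h u : smooth_at mP mP (mu_ h) u.
Proof.
have := smooth_at_comp (smooth_at_pair (smooth_at_id (mM := mP) u)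
  (smooth_at_cst (mN := mG) h u)) (smooth_at_act _); exact.
Qed.

Lemma smooth_at_mulg p :
  smooth_at (prod_manifold mG mG) mG (fun p => p.1 * p.2)%g p.
Proof. exact: msmooth_at (lie_mul_smooth (b := G)). Qed.

Lemma smooth_at_mulgl a k : smooth_at mG mG (fun k => a * k)%g k.
Proof.
have := smooth_at_comp (smooth_at_pair (smooth_at_cst (mM := mG) (mN := mG) a k)
  (smooth_at_id k)) (smooth_at_mulg _); exact.
Qed.

Lemma smooth_at_mulgr a k : smooth_at mG mG (fun k => k * a)%g k.
Proof.
have := smooth_at_comp (smooth_at_pair (smooth_at_id (mM := mG) k)
  (smooth_at_cst (mN := mG) a k)) (smooth_at_mulg _); exact.
Qed.

Lemma smooth_at_conj a k : smooth_at mG mG (fun k => a * k * a^-1)%g k.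
Proof. exact: smooth_at_comp (smooth_at_mulgl a k) (smooth_at_mulgr _ _). Qed.

Lemma smooth_at_iota p :
  smooth_at (Pxg_manifold (mP := mP) (G := G)) (tangent mP) (bundle_iota B) p.
Proof.
rewrite (_ : bundle_iota B = fun p =>
  tmap mP (fun q => mu q.1 q.2) (tpair (tzero mP p.1) (vec p.2))); last first.
  apply/funext => q; rewrite tmap_partial2 //; exact: smooth_at_act.
have s1 : smooth_at (prod_manifold mP (vect_manifold g)) (tangent mP)
    (fun q => tzero mP q.1) p.
  exact: smooth_at_comp (smooth_at_fst p) (smooth_at_tzero _).
have s2 : smooth_at (prod_manifold mP (vect_manifold g)) (tangent mG)
    (fun q => vec q.2) p.
  exact: smooth_at_comp (smooth_at_snd p) (smooth_at_vector (mM := mG) _).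
have s3 := smooth_at_comp (smooth_at_pair s1 s2) (smooth_at_tpair _).
exact: smooth_at_comp s3 (smooth_at_tmap (smooth_at_act _)).
Qed.

Lemma tag_iota u X : tag (bundle_iota B (u, X)) = u.
Proof. by rewrite /= bundle_act1. Qed.

(** The map iota(u, _) from the Lie algebra to T_uP; [tfib] is needed because
    [bundle_iota B (u, X)] sits over u 1, equal to u only by the action
    axiom. *)
Definition iota_fib (u : P) (X : g) : tspace mP u :=
  tfib u (bundle_iota B (u, X)).

Lemma iotaE u X : bundle_iota B (u, X) = existT (tspace mP) u (iota_fib u X).
Proof. by rewrite /iota_fib tfibK // tag_iota. Qed.

Lemma iota_fib_linear u : linear (iota_fib u).
Proof.
move=> r X Y; rewrite /iota_fib /bundle_iota !tmapE tdiff_linear.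
exact: tfib_linear.
Qed.

(** This follows from u k h = (u h) (h^-1 k h) by differentiating at k = 1. *)
Lemma iota_equivariant u X h :
  TP_act B (bundle_iota B (u, X)) h = bundle_iota B (Pxg_act B (u, X) h).
Proof.
rewrite /TP_act /bundle_iota /Pxg_act /= tmap_comp; first last.
- exact: smooth_at_translation.
- exact: smooth_at_orbit_map.
rewrite /Ad tfibK; last by rewrite /= mulg1 invgK mulVg.
rewrite tmap_comp; first last.
- exact: smooth_at_orbit_map.
- exact: smooth_at_conj.
congr (tmap mP _ _); apply/funext => k /=.
by rewrite !bundle_actM invgK !mulgA mulgV mul1g.
Qed.

Lemma tmap_pi_act v h : tmap mZ pi (TP_act B v h) = tmap mZ pi v.
Proof.
rewrite /TP_act tmap_comp; [|exact: smooth_at_translation|exact: smooth_at_pi].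
by congr (tmap mZ _ _); apply/funext => u /=; rewrite bundle_proj_act.
Qed.

Lemma PxTZ_ext (p q : PxTZ B) : (sval p).1 = (sval q).1 ->
  (sval p).2 = (sval q).2 -> p = q.
Proof.
case: p q => [[u w] e] [[u' w'] e'] /= eu ew; apply: eq_exist => /=.
by rewrite eu ew.
Qed.

Lemma Tproj_act v h : Tproj B (TP_act B v h) = PxTZ_act B (Tproj B v) h.
Proof. by apply: PxTZ_ext => //=; exact: tmap_pi_act. Qed.

Lemma tmap_pi_iota u X : tmap mZ pi (bundle_iota B (u, X)) = tzero mZ (pi u).
Proof.
rewrite /bundle_iota tmap_comp;
  [|exact: smooth_at_orbit_map|exact: smooth_at_pi].
rewrite -(tmap_cst (mN := mZ) (pi u) (vec X)).
by congr (tmap mZ _ _); apply/funext => k /=; rewrite bundle_proj_act.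
Qed.

(** The derivative at u of u' |-> t(u)^-1 t(u'), for t : P -> G; it takes values
    in the tangent space at 1, read in the chosen chart at 1.  When t is the
    second component of a local trivialization it is the flat connection form
    of that trivialization. *)
Definition local_form (t : P -> G) (v : TP) : g :=
  tcoord (chart_at mG (1%g : G)) (tmap mG (fun u => (t (tag v))^-1 * t u)%g v).

Lemma smooth_at_local_form (W : set P) t v : open_in mP W ->
  (forall u, W u -> smooth_at mP mG t u) -> W (tag v) ->
  smooth_at (tangent mP) (vect_manifold g) (local_form t) v.
Proof.
move=> oW st Wv; have sv := st _ Wv.
pose F (w : TP) : tbundle mG := tmap mG (fun p => p.1 * p.2)%g
  (tpair (tzero mG (t (tag w))^-1%g) (tmap mG t w)).
(* The base point t(u)^-1 varies with the vector; as a value of the tangent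
   map of the multiplication the form is visibly smooth in both. *)
have FE w : W (tag w) -> tcoord (chart_at mG (1%g : G)) (F w) = local_form t w.
  move=> /st sw; rewrite /F tmap_partial2; last exact: smooth_at_mulg.
  by rewrite tmap_comp //; exact: smooth_at_mulgl.
apply: smooth_at_eq (open_in_preimage (@smooth_at_tag _ _ mP) oW) _ FE _ => //.
have s1 : smooth_at (tangent mP) (tangent mG)
    (fun w => tzero mG (t (tag w))^-1%g) v.
  have s0 := smooth_at_comp (smooth_at_tag v) sv.
  have s1 := smooth_at_comp s0 (msmooth_at _ (lie_inv_smooth (b := G))).
  exact: smooth_at_comp s1 (smooth_at_tzero _).
have s2 := smooth_at_comp (smooth_at_pair s1 (smooth_at_tmap sv))
  (smooth_at_tpair _).
have s3 : smooth_at (tangent mP) (tangent mG) F v.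
  exact: smooth_at_comp s2 (smooth_at_tmap (smooth_at_mulg _)).
apply: smooth_at_comp s3 (smooth_at_tcoord _).
by rewrite /= mulVg; exact: cdom_at.
Qed.

Lemma local_form_linear t u :
  linear (fun a => local_form t (existT (tspace mP) u a)).
Proof.
by move=> r a b; rewrite /local_form !tmapE /= tdiff_linear tcoord_linear.
Qed.

(** The last two properties say that th is inverse to iota on vertical vectors;
    they contain the injectivity of iota and the inclusion of Ker (T pi) in its
    range. *)
Lemma local_connection_form u0 : exists W (th : TP -> g),
  [/\ open_in mP W /\ W u0,
      forall v, W (tag v) -> smooth_at (tangent mP) (vect_manifold g) th v,
      forall u, linear (fun a => th (existT (tspace mP) u a)),
      forall u X, W u -> th (bundle_iota B (u, X)) = X
    & forall v, W (tag v) -> tmap mZ pi v = tzero mZ (pi (tag v)) ->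
        bundle_iota B (tag v, th v) = v].
Proof.
have [V [t [s [[oV Vu0] [st ss] [tE sE] [tK sK] tM]]]] :=
  bundle_local_triv B (pi u0).
have oW := open_in_preimage smooth_at_pi oV.
have stW u : V (pi u) -> smooth_at mP (prod_manifold mZ mG) t u.
  by move=> Vu; exact: msmooth_on_at st Vu.
have st2 u : V (pi u) -> smooth_at mP mG (snd \o t) u.
  by move=> Vu; exact: smooth_at_comp (stW u Vu) (smooth_at_snd _).
exists (pi @^-1` V), (local_form (snd \o t)); split => //.
- by move=> v Vv; apply: (smooth_at_local_form oW) => //; exact: st2.
- exact: local_form_linear.
- move=> u X Vu; rewrite /local_form tag_iota /bundle_iota tmap_comp; first last.
  + have sk : smooth_at mG mP (mu u) (1%g : G) by exact: smooth_at_orbit_map.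
    apply: smooth_at_comp (smooth_at_mulgl _ _).
    by apply: st2; rewrite bundle_proj_act.
  + exact: smooth_at_orbit_map.
  rewrite (_ : _ \o _ = id) ?tmap_id ?tcoord_at //.
  by apply/funext => k /=; rewrite tM //= mulgA mulVg mul1g.
- move=> v Vv kv.
  set u := tag v in kv *; set w := tmap mG (snd \o t) v.
  have sV k : smooth_at (prod_manifold mZ mG) mP s (pi u, k).
    exact: msmooth_on_at ss _.
  (* Ts (Tt v) = v and the Z-component of Tt v is T pi v = 0. *)
  have Ev : v = tmap mP (fun k => s (pi u, k)) w.
    rewrite -(tmap_partial2 (mM := mZ)) // -kv.
    rewrite (tmap_near (g := fst \o t) oW Vv) //; last first.
    - exact: smooth_at_pi.
    - by move=> y Vy /=; rewrite tE.
    have s1 := smooth_at_comp (stW u Vv) (smooth_at_fst _).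
    rewrite -(tmap_pair s1 (st2 u Vv)).
    rewrite (_ : (fun _ => _) = t); last by apply/funext => y /=; case: (t y).
    have stu : smooth_at (prod_manifold mZ mG) mP s (t u).
      by rewrite [t u]surjective_pairing tE.
    rewrite tmap_comp //; last exact: stW.
    by rewrite -(tmap_near oW Vv (f := id)) ?tmap_id //; [
      move=> y Vy /=; rewrite tK|exact: smooth_at_id].
  rewrite /bundle_iota /local_form /= tcoord_atK; last by rewrite /= mulVg.
  rewrite -/u -(tmap_comp (mN := mG) (st2 u Vv) (smooth_at_mulgl _ _)) -/w.
  rewrite tmap_comp; [|exact: smooth_at_mulgl|exact: smooth_at_orbit_map].
  rewrite [RHS]Ev; congr (tmap mP _ _); apply/funext => k /=.
  set q := mu u _; have Vq : V (pi q) by rewrite bundle_proj_act.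
  rewrite -[LHS](tK _ Vq) /q tM // mulgA mulgV mul1g.
  by rewrite tE.
Qed.

(** The lift of (u, w) is the vector T s (w, 0), at the point (pi u, t2 u). *)
Lemma local_lift u0 : exists W (lam : PxTZ B -> TP),
  [/\ open_in mP W /\ W u0,
      forall p, W (sval p).1 ->
        smooth_at (PxTZ_manifold B) (tangent mP) lam p
    & forall p, W (sval p).1 -> Tproj B (lam p) = p].
Proof.
have [V [t [s [[oV Vu0] [st ss] [tE sE] [tK sK] tM]]]] :=
  bundle_local_triv B (pi u0).
have oW := open_in_preimage smooth_at_pi oV.
exists (pi @^-1` V),
  (fun p => tmap mP s (tpair (sval p).2 (tzero mG (t (sval p).1).2))).
split => //.
- move=> p Vp.
  have s1 := smooth_at_pullback_fst (bundle_proj_smooth B) p.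
  have s2 := smooth_at_pullback_snd (bundle_proj_smooth B) p.
  have s3 := smooth_at_comp s1 (msmooth_on_at st Vp).
  have s4 := smooth_at_comp (smooth_at_comp s3 (smooth_at_snd _))
    (smooth_at_tzero _).
  have s5 := smooth_at_comp (smooth_at_pair s2 s4) (smooth_at_tpair _).
  apply: smooth_at_comp s5 (smooth_at_tmap _).
  by apply: msmooth_on_at ss _; split => //=; rewrite -(svalP p).
- move=> p Vp; have Vp' : V (tag (sval p).2) by rewrite -(svalP p).
  have sp k : smooth_at (prod_manifold mZ mG) mP s (tag (sval p).2, k).
    exact: msmooth_on_at ss _.
  apply: PxTZ_ext => /=.
    by rewrite -(svalP p) -tE // -surjective_pairing tK.
  rewrite tmap_partial1 // tmap_comp; [ | |exact: smooth_at_pi].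
    rewrite -(tmap_near oV Vp' (f := id)) ?tmap_id //; last exact: smooth_at_id.
    by move=> z Vz /=; rewrite sE.
  have := smooth_at_comp (smooth_at_pair (smooth_at_id (mM := mZ) (tag (sval p).2))
    (smooth_at_cst (mN := mG) (t (sval p).1).2 _)) (sp _); exact.
Qed.

End Bundle_geometry.

(** * The correspondence between the four kinds of data *)

Section Connection_equivalences.
Context {R : realType} {P Z : Type} {mP : banach_manifold R P}
  {mZ : banach_manifold R Z} {G : banach_lie_group R}.
Context (B : principal_bundle mP mZ G).

Local Notation g := (lie_algebra G).
Local Notation TP := (tbundle mP).
Local Notation pi := (bundle_proj B).
Local Notation mu := (bundle_act B).
Local Notation iota := (bundle_iota B).
Local Notation vec u := (existT (tspace mP) u).
Local Notation dpi := (@tdiff _ _ _ mP mZ (bundle_proj B)).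
Implicit Types (chi : PxTZ B -> TP) (omega : TP -> g).

Lemma iota_inj u : injective (fun X => iota (u, X)).
Proof.
move=> X Y e; have [W [th [[_ Wu] _ _ thK _]]] := local_connection_form B u.
by rewrite -(thK u X) // -(thK u Y) // e.
Qed.

Lemma iota_fib_inj u : injective (iota_fib B u).
Proof. by move=> X Y e; apply: (@iota_inj u); rewrite !iotaE e. Qed.

Lemma qmap_iota p : qmap B (iota p) = p.2.
Proof.
rewrite /qmap /bundle_iota_inv; case: pselect => [e|[]]; last by exists p.
case: (cid e) => -[u X] /=; case: p e => [u' Y] e E.
have eu : u = u' by have := congr1 (@tag _ _) E; rewrite !tag_iota.
by rewrite eu in E; exact: (@iota_inj u').
Qed.

Lemma vertical_iota v : tmap mZ pi v = tzero mZ (pi (tag v)) ->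
  exists X, v = iota (tag v, X).
Proof.
have [W [th [[_ Wv] _ _ _ thv]]] := local_connection_form B (tag v).
by move=> kv; exists (th v); rewrite thv.
Qed.

Lemma iota_vertical u X : (tfiber mP u `&` tker mZ pi) (iota (u, X)).
Proof.
split; first exact: tag_iota.
by rewrite /tker /mkset tag_iota; exact: tmap_pi_iota.
Qed.

Lemma Tproj_surj p : exists v, Tproj B v = p.
Proof.
have [W [lam [[_ Wp] _ lamK]]] := local_lift B (sval p).1.
by exists (lam p); exact: lamK.
Qed.

Lemma TprojE u (a : tspace mP u) : Tproj B (vec u a) = PxTZ_pair (dpi a).
Proof. by []. Qed.

Lemma PxTZ_pair_inj u : injective (@PxTZ_pair _ _ _ mP mZ G B u).
Proof.
move=> w w' /(congr1 (fun p => (sval p).2)) /=; exact: existT_tspace_inj.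
Qed.

Lemma dpi_iota_fib u X : dpi (iota_fib B u X) = 0.
Proof. by apply: existT_tspace_inj; rewrite -tmapE -iotaE tmap_pi_iota. Qed.

Lemma ker_dpi u (a : tspace mP u) : dpi a = 0 -> exists X, a = iota_fib B u X.
Proof.
move=> da; have [|X] := @vertical_iota (vec u a); first by rewrite tmapE da.
by rewrite iotaE => e; exists X; exact: existT_tspace_inj e.
Qed.

Lemma connection_form_left omega :
  connection_form B omega <-> left_splitting B (fun v => (tag v, omega v)).
Proof.
split=> [[so lo io eo]|[lo so eo io]].
  split.
  - by move=> u; exists (fun v => omega (vec u v)).
  - apply: at_msmooth => v.
    exact: smooth_at_pair (smooth_at_tag v) (msmooth_at _ so).
  - by move=> v h; rewrite /Pxg_act /TP_act /= eo.
  - by move=> [u X]; rewrite {1}/bundle_iota tag_iota [omega _]io.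
split.
- apply: at_msmooth => v.
  exact: smooth_at_comp (msmooth_at v so)
    (smooth_at_snd (mN := vect_manifold g) _).
- move=> u r a b; have [L lL LE] := lo u.
  have LE2 c : omega (vec u c) = L c by have := congr1 snd (LE c).
  by rewrite !LE2 lL.
- by move=> u X; have := congr1 snd (io (u, X)).
- by move=> h v; have := congr1 snd (eo v h).
Qed.

Lemma left_splittingE psi : left_splitting B psi ->
  psi = fun v => (tag v, (psi v).2).
Proof.
move=> [lp _ _ _]; apply/funext => -[u a]; have [L _ ->] := lp u.
by [].
Qed.

Section From_form.
Variables (omega : TP -> g) (co : connection_form B omega).

Lemma form_iota u X : omega (iota (u, X)) = X.
Proof. by have [_ _ io _] := co; exact: io. Qed.

(* The projection onto the vertical subbundle defined by omega. *)
Let Phi v := iota (tag v, omega v).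

Lemma smooth_at_vertical v : smooth_at (tangent mP) (tangent mP) Phi v.
Proof.
have [so _ _ _] := co.
apply: smooth_at_comp (smooth_at_iota B _).
exact: smooth_at_pair (smooth_at_tag v) (msmooth_at v so).
Qed.

Lemma vertical_equivariant v h : TP_act B (Phi v) h = Phi (TP_act B v h).
Proof.
by have [_ _ _ eo] := co; rewrite /Phi iota_equivariant /Pxg_act /= -eo.
Qed.

Lemma form_principal_connection : principal_connection B Phi.
Proof.
have [so lo io eo] := co.
split; last by move=> h v; exact: vertical_equivariant.
split.
- by apply: at_msmooth => v; exact: smooth_at_vertical.
- by move=> v; rewrite {1}/Phi form_iota tag_iota.
- move=> u; exists (fun a => iota_fib B u (omega (vec u a))).
    by move=> r a b; rewrite lo iota_fib_linear.
  by move=> a; rewrite /Phi iotaE.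
- move=> u; apply/seteqP; split => [_ [v <- <-]|v [vu kv]].
    exact: iota_vertical.
  exists v => //; rewrite -[RHS](_ : iota (tag v, omega v) = v) //.
  have [X ->] := vertical_iota kv.
  by rewrite tag_iota form_iota.
Qed.

(** The component of v in Ker omega. *)
Definition horizontal_part (v : TP) : TP := tsub v (Phi v).

Lemma horizontalE u (a : tspace mP u) : horizontal_part (vec u a) =
  vec u (a - iota_fib B u (omega (vec u a))).
Proof. by rewrite /horizontal_part /Phi iotaE tsubE. Qed.

Lemma horizontal_fib_linear u :
  linear (fun a : tspace mP u => a - iota_fib B u (omega (vec u a))).
Proof.
have [_ lo _ _] := co; move=> r a b.
by rewrite lo iota_fib_linear scalerBr opprD addrACA.
Qed.

Lemma Tproj_horizontal v : Tproj B (horizontal_part v) = Tproj B v.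
Proof.
case: v => u a; rewrite horizontalE !TprojE; congr PxTZ_pair.
by rewrite tdiffB dpi_iota_fib subr0.
Qed.

(** Two lifts of the same vector differ by a vertical vector, which has no
    horizontal part. *)
Lemma horizontal_Tproj v w : Tproj B v = Tproj B w ->
  horizontal_part v = horizontal_part w.
Proof.
case: v w => [u a] [u' b] e.
have eu : u = u' by exact: (congr1 (fun p => (sval p).1) e).
case: u' / eu b e => b; rewrite !TprojE => ab; have e := PxTZ_pair_inj ab.
have [X Xab] : exists X, a - b = iota_fib B u X.
  by apply: ker_dpi; rewrite tdiffB e subrr.
rewrite !horizontalE; congr existT; apply/eqP; rewrite -subr_eq0; apply/eqP.
have := @horizontal_fib_linear u (-1) b a.
rewrite !scaleN1r [- b + a]addrC [- (b - _) + _]addrC => <-.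
by rewrite Xab -iotaE form_iota subrr.
Qed.

(** The right splitting defined by omega: the horizontal part of an arbitrary
    lift of p.  The lift is chosen, but by [horizontal_liftE] the result does
    not depend on it. *)
Definition horizontal_lift (p : PxTZ B) : TP :=
  horizontal_part (sval (cid (Tproj_surj p))).

Lemma horizontal_liftE v : horizontal_lift (Tproj B v) = horizontal_part v.
Proof.
by rewrite /horizontal_lift; case: cid => w /= e; exact: horizontal_Tproj.
Qed.

Lemma horizontal_lift_splitting : right_splitting B horizontal_lift.
Proof.
split.
- move=> u.
  pose L (w : tspace mZ (pi u)) := tfib u (horizontal_lift (PxTZ_pair w)).
  have LE (a : tspace mP u) :
      L (dpi a) = a - iota_fib B u (omega (vec u a)).
    by rewrite /L -TprojE horizontal_liftE horizontalE tfibE.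
  have lift w : exists a : tspace mP u, dpi a = w.
    have [v e] := Tproj_surj (PxTZ_pair w).
    case: v e => u' a e; have eu : u = u'.
      by exact: (esym (congr1 (fun p => (sval p).1) e)).
    by case: u' / eu a e => a e; exists a; exact: PxTZ_pair_inj e.
  exists L.
    move=> r w w'; have [a <-] := lift w; have [b <-] := lift w'.
    by rewrite -(tdiff_linear (mN := mZ) pi) !LE horizontal_fib_linear.
  move=> w; have [a <-] := lift w.
  by rewrite LE -horizontalE -TprojE horizontal_liftE.
- apply: at_msmooth => p.
  have [W [lam [[oW Wp] slam lamK]]] := local_lift B (sval p).1.
  have oW' :=
    open_in_preimage (smooth_at_pullback_fst (bundle_proj_smooth B)) oW.
  apply: (smooth_at_eq oW' (f := horizontal_part \o lam)) => //.
    by move=> q Wq /=; rewrite -horizontal_liftE lamK.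
  apply: smooth_at_comp (slam p Wp) _.
  apply: smooth_at_tsub; last exact: smooth_at_vertical.
    by move=> v; rewrite tag_iota.
  exact: smooth_at_id.
- move=> p h; have [v <-] := Tproj_surj p.
  rewrite -Tproj_act !horizontal_liftE /horizontal_part -vertical_equivariant.
  by rewrite /TP_act tmap_tsub // tag_iota.
- move=> p; have [v <-] := Tproj_surj p.
  by rewrite horizontal_liftE Tproj_horizontal.
Qed.

Lemma horizontal_lift_relation v :
  tadd (iota (tag v, omega v)) (horizontal_lift (Tproj B v)) = v.
Proof.
rewrite horizontal_liftE; case: v => u a.
by rewrite horizontalE iotaE taddE addrC subrK.
Qed.

(** A connection form with a right splitting related to it determines the
    whole quadruple. *)
Lemma corresponding_form chi : right_splitting B chi ->
  (forall v, tadd (iota (tag v, omega v)) (chi (Tproj B v)) = v) ->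
  corresponding B chi (fun v => (tag v, omega v)) omega Phi.
Proof.
move=> rc rel; split => //; first exact/connection_form_left.
  exact: form_principal_connection.
by split => // v; rewrite /Phi qmap_iota.
Qed.

End From_form.

Lemma tag_right_splitting chi p : right_splitting B chi ->
  tag (chi p) = (sval p).1.
Proof.
by move=> [_ _ _ cK]; rewrite -[LHS]/((sval (Tproj B (chi p))).1) cK.
Qed.

(** The vector v - chi (Tproj v) is vertical, and omega v is the element of the
    Lie algebra that iota sends to it. *)
Lemma right_splitting_form chi : right_splitting B chi ->
  exists2 omega, connection_form B omega &
    forall v, tadd (iota (tag v, omega v)) (chi (Tproj B v)) = v.
Proof.
move=> rc; have tc v : tag v = tag (chi (Tproj B v)).
  by rewrite tag_right_splitting.
have [lc sc ec cK] := rc.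
pose ver v := tsub v (chi (Tproj B v)); pose omega v := qmap B (ver v).
have verK v : tmap mZ pi (ver v) = tzero mZ (pi (tag v)).
  rewrite tmap_tsub //.
  have := cK (Tproj B v) => /(congr1 (fun p => (sval p).2)).
  by move=> /= ->; rewrite tsubE subrr.
have oE v : iota (tag v, omega v) = ver v.
  by have [X e] := vertical_iota (verK v); rewrite /omega e qmap_iota.
have sT v : smooth_at (tangent mP) (tangent mP) (chi \o Tproj B) v.
  apply: smooth_at_comp (msmooth_at _ sc).
  apply: smooth_at_pullback; first exact: smooth_at_tag.
  by apply: smooth_at_tmap; exact: smooth_at_pi.
exists omega; last first.
  move=> v; rewrite oE /ver; move: (tc v); case: v => u a.
  by case: (chi _) => u' b /= e; case: u' / e b => b; rewrite tsubE taddE subrK.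
split.
- apply: at_msmooth => v.
  have [W [th [[oW Wv] sth _ thK _]]] := local_connection_form B (tag v).
  have oW' := open_in_preimage (@smooth_at_tag _ _ mP) oW.
  apply: (smooth_at_eq oW' (f := th \o ver)) => //.
    by move=> w Ww /=; rewrite -oE thK.
  apply: smooth_at_comp (sth _ _) => //.
  exact: smooth_at_tsub tc (smooth_at_id _) (sT v).
- move=> u r a b; apply: (@iota_fib_inj u).
  have [L lL LE] := lc u.
  have E a' : iota_fib B u (omega (vec u a')) = a' - L (dpi a').
    apply: existT_tspace_inj; rewrite -iotaE (oE (vec u a')) /ver TprojE LE.
    exact: tsubE.
  rewrite iota_fib_linear !E tdiff_linear lL.
  by rewrite scalerBr opprD addrACA.
- move=> u X; apply: (@iota_inj u); rewrite -/(iota (u, X)).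
  have [L lL LE] := lc u.
  rewrite -{1}(tag_iota B u X) oE /ver iotaE TprojE dpi_iota_fib LE.
  have -> : L 0 = 0.
    by have := lL (-1) 0 0; rewrite scaler0 addr0 scaleN1r addNr.
  by rewrite tsubE subr0.
- move=> h v; apply: (@iota_inj (mu (tag v) h)).
  have := oE (TP_act B v h); rewrite /= => ->.
  rewrite /ver Tproj_act ec -tmap_tsub // -[tsub _ _]oE.
  exact: iota_equivariant.
Qed.

Lemma connection_iota Phi v : connection mZ pi Phi ->
  Phi v = iota (tag v, qmap B (Phi v)).
Proof.
move=> [_ _ _ rP].
have : (Phi @` tfiber mP (tag v)) (Phi v) by exists v.
rewrite rP => -[/= tv kv].
have [X e] := vertical_iota kv.
by rewrite {2}e qmap_iota -tv.
Qed.

Lemma principal_connection_form Phi : principal_connection B Phi ->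
  connection_form B (qmap B \o Phi).
Proof.
move=> [cP eP]; have PE v := connection_iota v cP.
have [sP idP lP rP] := cP; split.
- apply: at_msmooth => v.
  have [W [th [[oW Wv] sth _ thK _]]] := local_connection_form B (tag v).
  have oW' := open_in_preimage (@smooth_at_tag _ _ mP) oW.
  apply: (smooth_at_eq oW' (f := th \o Phi)) => //.
    by move=> w Ww /=; rewrite {1}PE thK.
  apply: smooth_at_comp (msmooth_at v sP) (sth _ _).
  by rewrite PE tag_iota.
- move=> u r a b; apply: (@iota_fib_inj u) => /=.
  have [L lL LE] := lP u.
  have E a' : iota_fib B u (qmap B (Phi (vec u a'))) = L a'.
    by apply: existT_tspace_inj; rewrite -iotaE -(PE (vec u a')) LE.
  by rewrite iota_fib_linear !E lL.
- move=> u X; rewrite -/(iota (u, X)) /=.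
  have : (Phi @` tfiber mP u) (iota (u, X)).
    by rewrite rP; exact: iota_vertical.
  by move=> [w _ e]; rewrite -e idP e qmap_iota.
- move=> h v /=; rewrite -eP PE -/(TP_act B _ h) iota_equivariant.
  by rewrite !qmap_iota.
Qed.

End Connection_equivalences.

Arguments horizontal_lift {R P Z mP mZ G} B omega p.

Theorem theorem2p5 (R : realType) (P Z : Type) (mP : banach_manifold R P)
    (mZ : banach_manifold R Z) (G : banach_lie_group R)
    (B : principal_bundle mP mZ G) :
  [/\ (exists chi, right_splitting B chi) <-> (exists psi, left_splitting B psi),
       (exists psi, left_splitting B psi) <->
         (exists omega, connection_form B omega)
     & (exists omega, connection_form B omega) <->
         (exists Phi, principal_connection B Phi)] /\
  [/\ forall chi, right_splitting B chi ->
         exists psi omega Phi, corresponding B chi psi omega Phi,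
       forall psi, left_splitting B psi ->
         exists chi omega Phi, corresponding B chi psi omega Phi,
       forall omega, connection_form B omega ->
         exists chi psi Phi, corresponding B chi psi omega Phi,
       forall Phi, principal_connection B Phi ->
         exists chi psi omega, corresponding B chi psi omega Phi
     & forall chi psi omega Phi chi' psi' omega' Phi',
         corresponding B chi psi omega Phi ->
         corresponding B chi' psi' omega' Phi' ->
         [/\ chi = chi' <-> psi = psi', psi = psi' <-> omega = omega'
           & omega = omega' <-> Phi = Phi']].
Proof.
have from_chi chi : right_splitting B chi ->
    exists psi omega Phi, corresponding B chi psi omega Phi.
  move=> rc; have [omega co rel] := right_splitting_form rc.
  by do 3!eexists; refine (corresponding_form co rc rel).
have from_omega omega : connection_form B omega ->
    exists chi, corresponding B chi (fun v => (tag v, omega v)) omega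
      (fun v => bundle_iota B (tag v, omega v)).
  move=> co; exists (horizontal_lift B omega).
  apply: corresponding_form => //; first exact: horizontal_lift_splitting.
  exact: horizontal_lift_relation.
have from_psi psi : left_splitting B psi ->
    exists chi omega Phi, corresponding B chi psi omega Phi.
  move=> lp; have e := left_splittingE lp; rewrite e in lp *.
  have [chi c] := from_omega _ (proj2 (connection_form_left _ _) lp).
  by do 3!eexists; exact: c.
have from_Phi Phi : principal_connection B Phi ->
    exists chi psi omega, corresponding B chi psi omega Phi.
  move=> pP; have [chi c] := from_omega _ (principal_connection_form pP).
  have e : Phi = fun v => bundle_iota B (tag v, qmap B (Phi v)).
    by apply/funext => v; exact: connection_iota pP.1.
  by rewrite e; do 3!eexists; exact: c.
split.
  split; split.
  - by move=> [chi /from_chi[psi [omega [Phi [_ ? _ _ _]]]]]; exists psi.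
  - by move=> [psi /from_psi[chi [omega [Phi [? _ _ _ _]]]]]; exists chi.
  - by move=> [psi /from_psi[chi [omega [Phi [_ _ ? _ _]]]]]; exists omega.
  - by move=> [omega /from_omega[chi [_ ? _ _ _]]]; eexists; eassumption.
  - by move=> [omega /from_omega[chi [_ _ _ ? _]]]; eexists; eassumption.
  - by move=> [Phi /from_Phi[chi [psi [omega [_ _ ? _ _]]]]]; exists omega.
split => //.
  by move=> omega /from_omega[chi c]; do 3!eexists; exact: c.
move=> chi psi omega Phi chi' psi' omega' Phi' [rc _ _ _ [relc ps ph om]]
  [rc' _ _ _ [relc' ps' ph' om']].
have psi_omega : psi = psi' <-> omega = omega'.
  split=> e; apply/funext => v; last by rewrite ps ps' e.
  by have := congr1 snd (congr1 (fun h => h v) e); rewrite ps ps'.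
have omega_Phi : omega = omega' <-> Phi = Phi'.
  split=> e; last by apply/funext => v; rewrite om om' e.
  by apply/funext => v; rewrite ph ph' (proj2 psi_omega e).
have tE (f : tbundle mP -> lie_algebra G) v w :
    tadd (bundle_iota B (tag v, f v)) w =
    existT (tspace mP) (tag v) (iota_fib B (tag v) (f v) + tfib (tag v) w).
  by rewrite iotaE.
split=> //; split=> e; apply/funext.
  move=> v; rewrite ps ps'; congr pair.
  apply: (@iota_fib_inj _ _ _ _ _ _ B (tag v)).
  have := relc v; rewrite -[in RHS](relc' v) ps ps' !tE e.
  by move=> /(@existT_tspace_inj _ _ _ _ _ _)/addIr.
move=> p; have [v <-] := Tproj_surj p.
have := relc v; rewrite -[in RHS](relc' v) e ps' !tE.
move=> /(@existT_tspace_inj _ _ _ _ _ _)/addrI E.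
rewrite -(tfibK (tag_right_splitting (Tproj B v) rc)).
by rewrite -(tfibK (tag_right_splitting (Tproj B v) rc')) /= E.
Qed.
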